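(* Let $a\in[0,1]$, let $\mathcal A$ be a monotone graph property, let $m=n^{\alpha}$ with a constant $\alpha>4$, and let $$\Omega\!\left(\frac{1}{n\sqrt[3]{m}}\right)=p=O\!\left(\sqrt{\frac{\ln n}{m}}\right).$$ Put $$p_-=1-\exp(-mp^2(1-p)^{n-2}),\qquad p_+=1-\exp(-mp^2(1-p)^{n-2})+10\sqrt[3]{mp^3}.$$ If $\Pr\{G(n,p_-)\in\mathcal A\}\to a$ and $\Pr\{G(n,p_+)\in\mathcal A\}\to a$, then $\Pr\{\mathcal G(n,m,p)\in\mathcal A\}\to a$.
   Context: $G(n,p)$ denotes the binomial random graph on an $n$-element vertex set, each edge present independently with probability $p$. The random intersection graph $\mathcal G(n,m,p)$: vertex set $\mathcal V$, $|\mathcal V|=n$, object set $\mathcal W$, $|\mathcal W|=m$; each vertex $v$ receives $W(v)\subseteq\mathcal W$ with the events $w\in W(v)$ independent of probability $p$ for all $(v,w)$; $v_1\ne v_2$ are adjacent iff $W(v_1)\cap W(v_2)\ne\emptyset$. A graph property (isomorphism-closed family of graphs on the vertex set) is monotone if it is closed under adding edges or closed under deleting edges. Limits are as $n\to\infty$. *)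

(* Defs.v *)
From Stdlib Require Import Reals.
From HB Require Import structures.
From mathcomp Require Import all_boot all_fingroup.

Set Implicit Arguments.
Unset Strict Implicit.
Unset Printing Implicit Defensive.
Local Open Scope R_scope.

Definition sumR (T : finType) (f : T -> R) : R :=
  foldr (fun x acc => Rplus (f x) acc) 0 (enum T).

Definition simple_graph (n : nat) (G : {set 'I_n * 'I_n}) : bool :=
  [forall i : 'I_n, (i, i) \notin G] &&
  [forall i : 'I_n, forall j : 'I_n, ((i, j) \in G) ==> ((j, i) \in G)].

Definition n_edges (n : nat) (G : {set 'I_n * 'I_n}) : nat := (#|G| %/ 2)%nat.

Definition graph_property := forall n : nat, {set 'I_n * 'I_n} -> bool.

Definition relabel (n : nat) (s : {perm 'I_n}) (G : {set 'I_n * 'I_n}) :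
  {set 'I_n * 'I_n} := [set (s x.1, s x.2) | x in G].

Definition iso_closed (A : graph_property) : Prop :=
  forall (n : nat) (s : {perm 'I_n}) (G : {set 'I_n * 'I_n}),
    simple_graph G -> A n (relabel s G) = A n G.

Definition increasing_prop (A : graph_property) : Prop :=
  forall (n : nat) (G H : {set 'I_n * 'I_n}),
    simple_graph G -> simple_graph H -> G \subset H -> A n G -> A n H.

Definition decreasing_prop (A : graph_property) : Prop :=
  forall (n : nat) (G H : {set 'I_n * 'I_n}),
    simple_graph G -> simple_graph H -> G \subset H -> A n H -> A n G.

Definition monotone_property (A : graph_property) : Prop :=
  iso_closed A /\ (increasing_prop A \/ decreasing_prop A).

(* Pr{ G(n,q) \in A }: each of the C(n,2) edges present independently with
   probability q.  The edge probability is clamped to [0,1] (q > 1 means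
   the complete graph, q < 0 the empty graph). *)
Definition clamp01 (q : R) : R := Rmax 0 (Rmin 1 q).

Definition prob_Gnp (A : graph_property) (n : nat) (q : R) : R :=
  let q' := clamp01 q in
  sumR (fun G : {set 'I_n * 'I_n} =>
    if simple_graph G && A n G then
      (q' ^ n_edges G * (1 - q') ^ ('C(n, 2) - n_edges G)%nat)
    else 0).

(* Random intersection graph: a configuration S : {set 'I_n * 'I_m} with
   (v,w) \in S  iff  w \in W(v); each of the n*m events independent with
   probability p. *)
Definition intersection_graph (n m : nat) (S : {set 'I_n * 'I_m}) :
  {set 'I_n * 'I_n} :=
  [set x : 'I_n * 'I_n | (x.1 != x.2) &&
     [exists w : 'I_m, ((x.1, w) \in S) && ((x.2, w) \in S)]].

Definition prob_Gnmp (A : graph_property) (n m : nat) (p : R) : R :=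
  sumR (fun S : {set 'I_n * 'I_m} =>
    if A n (intersection_graph S) then
      (p ^ #|S| * (1 - p) ^ (n * m - #|S|)%nat)
    else 0).

Definition cbrt (x : R) : R := Rpower x (1/3).

Definition p_minus (n m : nat) (p : R) : R :=
  (1 - exp (- (INR m * p ^ 2 * (1 - p) ^ (n - 2)%nat))).

Definition p_plus (n m : nat) (p : R) : R :=
  (1 - exp (- (INR m * p ^ 2 * (1 - p) ^ (n - 2)%nat)) + 10 * cbrt (INR m * p ^ 3)).

(* Main.v *)
(** Proof idea.  Per object, at most three vertices choose it up to an error of
order [(n p)^4], and exchanging the single clique it creates for independent
cliques, present with probability [1 - exp (- r)] where [r] is the chance that
the object creates that clique, costs another [(n p)^4].  After [m] objects this
yields, up to [O (m (n p)^4) = o(1)], the union of [G(n, p_minus)] with a random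
family of triangles, each present independently with probability
[pi <= m p^3].  This gives the lower comparison at once.

For the upper one it remains to couple the triangles with an independent
[G(n, q)], [q = 10 (m p^3)^(1/3)], so that [q^3 >= 1000 pi].  Following Riordan,
examine the triples one at a time; the test for a triple [i], given that the
triples in [Y] were accepted and others rejected, succeeds with conditional
probability at least [pi] by Harris' inequality, unless [i] and [Y] form a rare
bad configuration (three triangles closing up around an edge, or too many
triangles touching [i]).  Bad configurations are counted by an increasing
function [Z] of the family whose mean is a polynomial in [n^2 m p^3 = o(1)]. *)

Require Import Defs.
From Stdlib Require Import Reals.
From Stdlib Require Import Lra Lia.
Local Open Scope R_scope.

(** * Asymptotics of the parameters *)

(** No probability space is built. A random graph is the operator that sends a function of graphs to
    its mean, defined by recursion on the coins. The union of independent graphs is then a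
    composition of operators, [m] objects are an iterate, and equal cliques merge by an identity.
    The obstacle in the upper comparison is that triangles of G(n,q) sharing an edge are dependent,
    so rejecting one lowers the chance of its neighbours. The factor 1000 leaves so much room that a
    test can fail only if the expected number of neighbouring triangles, given the accepted ones, is
    at least 0.999. Failures are not counted along the coupled process, whose law is hard to
    describe. They are charged to [Z]: accepting at a bad step raises it by at least 1, the largest
    value of the function being compared, so that branch can be discarded. Only the mean of [Z]
    under independent triangles remains at the end. *)

Lemma ln_cube_bound (x g : R) : 1 < x -> 0 < g ->
  ln x ^ 3 <= Rpower x (3 * g) / g ^ 3.
Proof.
intros x1 g0.
assert (L0 : 0 < ln x) by (rewrite <- ln_1; apply ln_increasing; lra).
assert (P0 : 0 < Rpower x g) by apply exp_pos.
assert (h : g * ln x <= Rpower x g).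
{ unfold Rpower. pose proof (exp_ineq1_le (g * ln x)). lra. }
replace (Rpower x (3 * g)) with (Rpower x g ^ 3).
2:{ rewrite Rmult_comm, <- Rpower_mult. symmetry.
    replace 3 with (INR 3) by (simpl; lra). apply Rpower_pow; exact P0. }
apply Rmult_le_reg_r with (g ^ 3); [apply pow_lt; lra|].
unfold Rdiv. rewrite Rmult_assoc, Rinv_l, Rmult_1_r by (apply pow_nonzero; lra).
rewrite <- Rpow_mult_distr. apply pow_incr. split; [|lra].
apply Rmult_le_pos; lra.
Qed.

Lemma density_to_0 (alpha : R) (m : nat -> nat) : 4 < alpha ->
    (forall n : nat, INR (m n) <= Rpower (INR n) alpha < INR (m n) + 1) ->
  forall eps : R, 0 < eps -> exists N : nat, forall n : nat, (N <= n)%nat ->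
    3 <= INR n /\ 0 < INR (m n) /\
    INR n ^ 4 * ln (INR n) ^ 3 / INR (m n) < eps.
Proof.
intros a4 hm eps e0.
(* With this [g], n^alpha = n^4 (n^(3g))^2: one factor n^(3g) absorbs (ln n)^3, the other tends to
   infinity. *)
set (g := (alpha - 4) / 6).
assert (g0 : 0 < g) by (unfold g; lra).
assert (g3 : 0 < g ^ 3) by (apply pow_lt; lra).
set (M := 2 / (g ^ 3 * eps) + 1).
assert (M0 : 0 < 2 / (g ^ 3 * eps)).
{ apply Rdiv_lt_0_compat; [lra|apply Rmult_lt_0_compat; lra]. }
destruct (INR_unbounded (Rpower M (/ (3 * g)) + 3)) as [N hN].
exists N; intros n Nn.
assert (hn : INR N <= INR n) by (apply le_INR; exact Nn).
assert (pos : 0 < Rpower M (/ (3 * g))) by apply exp_pos.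
assert (n3 : 3 <= INR n) by lra.
split; [exact n3|].
assert (big : M < Rpower (INR n) (3 * g)).
{ rewrite <- (Rpower_1 M) at 1 by (unfold M; lra).
  replace 1 with (/ (3 * g) * (3 * g)) by (field; lra).
  rewrite <- Rpower_mult.
  apply Rlt_Rpower_l; [lra|]. split; lra. }
set (P := Rpower (INR n) (3 * g)) in *.
assert (an : Rpower (INR n) alpha = INR n ^ 4 * (P * P)).
{ unfold P. rewrite <- Rpower_plus.
  replace (INR n ^ 4) with (Rpower (INR n) (INR 4)) by (apply Rpower_pow; lra).
  rewrite <- Rpower_plus. f_equal. unfold g. simpl. lra. }
assert (n4 : 81 <= INR n ^ 4).
{ replace 81 with (3 ^ 4) by lra. apply pow_incr; lra. }
assert (P1 : 1 < P) by (unfold M in big; lra).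
(* n^alpha < m + 1 and n^alpha >= 81 give m > 80, so rounding down costs at most a factor 2. *)
assert (hm' : INR n ^ 4 * (P * P) <= 2 * INR (m n)).
{ pose proof (hm n) as [_ h]. rewrite an in h.
  assert (81 <= INR n ^ 4 * (P * P)) by nra. lra. }
assert (m0 : 0 < INR (m n)) by nra.
split; [exact m0|].
assert (L : ln (INR n) ^ 3 <= P / g ^ 3) by (apply ln_cube_bound; lra).
apply Rmult_lt_reg_r with (INR (m n)); [exact m0|].
unfold Rdiv. rewrite Rmult_assoc, Rinv_l, Rmult_1_r by lra.
apply Rle_lt_trans with (INR n ^ 4 * (P / g ^ 3)).
{ apply Rmult_le_compat_l; lra. }
apply Rlt_le_trans with (eps * (INR n ^ 4 * (P * P) / 2)).
2:{ apply Rmult_le_compat_l; lra. }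
replace (INR n ^ 4 * (P / g ^ 3)) with (INR n ^ 4 * P * eps / 2 * (2 / (g ^ 3 * eps)))
  by (field; split; lra).
replace (eps * (INR n ^ 4 * (P * P) / 2)) with (INR n ^ 4 * P * eps / 2 * P) by field.
apply Rmult_lt_compat_l; [|unfold M in big; lra].
apply Rmult_lt_0_compat; [|lra]. apply Rmult_lt_0_compat; [|lra]. nra.
Qed.

Lemma cbrt_cube (x : R) : 0 < x -> cbrt x ^ 3 = x.
Proof.
intros x0; unfold cbrt.
rewrite <- Rpower_pow by apply exp_pos.
rewrite Rpower_mult.
replace (1 / 3 * INR 3) with 1 by (simpl; lra).
apply Rpower_1; exact x0.
Qed.

(* With [w = n^4 (ln n)^3 / m] one has [(n^2 m p^3)^2 <= C^6 w] and
   [m (n p)^4 <= C^4 w]. *)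
Lemma regime (alpha C : R) (m : nat -> nat) (p : nat -> R) : 4 < alpha ->
    (forall n : nat, INR (m n) <= Rpower (INR n) alpha < INR (m n) + 1) ->
    (forall n : nat, 0 <= p n <= 1) -> 0 < C ->
    (exists N : nat, forall n : nat, (N <= n)%nat ->
      p n <= C * sqrt (ln (INR n) / INR (m n))) ->
  forall eps : R, 0 < eps -> exists N : nat, forall n : nat, (N <= n)%nat ->
    3 <= INR n /\ 0 < INR (m n) /\
    INR n ^ 2 * (INR (m n) * p n ^ 3) < eps /\ INR (m n) * (INR n * p n) ^ 4 < eps.
Proof.
intros a4 hm p01 C0 [N0 hp] eps e0.
assert (c6 : 0 < C ^ 6) by (apply pow_lt; exact C0).
assert (c4 : 0 < C ^ 4) by (apply pow_lt; exact C0).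
set (d := Rmin (eps ^ 2 / C ^ 6) (eps / C ^ 4)).
assert (d0 : 0 < d).
{ apply Rmin_glb_lt; apply Rdiv_lt_0_compat; try assumption. apply pow_lt; exact e0. }
destruct (density_to_0 alpha m a4 hm d d0) as [N1 h1].
exists (N0 + N1)%nat; intros n hn.
destruct (h1 n ltac:(lia)) as [n3 [m0 w]].
assert (hpn := hp n ltac:(lia)).
split; [exact n3|]; split; [exact m0|].
set (x := INR n) in *; set (M := INR (m n)) in *; set (L := ln x) in *.
(* From n >= 3 >= e. This lets (ln n)^2 be replaced by (ln n)^3 in the second bound. *)
assert (L1 : 1 <= L).
{ apply Rnot_lt_le; intro h. apply exp_increasing in h.
  unfold L in h. rewrite exp_ln in h by lra. pose proof exp_le_3. lra. }
assert (LM : 0 < L / M) by (apply Rdiv_lt_0_compat; lra).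
assert (p2 : p n ^ 2 <= C ^ 2 * (L / M)).
{ replace (C ^ 2 * (L / M)) with ((C * sqrt (L / M)) ^ 2).
  - apply pow_incr. split; [apply p01|exact hpn].
  - rewrite Rpow_mult_distr, pow2_sqrt; [reflexivity|lra]. }
assert (p2_0 : 0 <= p n ^ 2) by apply pow2_ge_0.
assert (x4 : 0 < x ^ 4) by (apply pow_lt; lra).
set (W := x ^ 4 * L ^ 3 / M) in *.
assert (W1 : C ^ 6 * W < eps ^ 2).
{ assert (h : W < eps ^ 2 / C ^ 6) by (apply Rlt_le_trans with d; [exact w|apply Rmin_l]).
  apply (Rmult_lt_compat_l (C ^ 6)) in h; [|exact c6].
  replace (C ^ 6 * (eps ^ 2 / C ^ 6)) with (eps ^ 2) in h by (field; lra). exact h. }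
assert (W2 : C ^ 4 * W < eps).
{ assert (h : W < eps / C ^ 4) by (apply Rlt_le_trans with d; [exact w|apply Rmin_r]).
  apply (Rmult_lt_compat_l (C ^ 4)) in h; [|exact c4].
  replace (C ^ 4 * (eps / C ^ 4)) with eps in h by (field; lra). exact h. }
split.
- assert (z0 : 0 <= x ^ 2 * (M * p n ^ 3)).
  { apply Rmult_le_pos; [apply pow2_ge_0|]. apply Rmult_le_pos; [lra|].
    apply pow_le, p01. }
  assert (zz : (x ^ 2 * (M * p n ^ 3)) ^ 2 <= C ^ 6 * W).
  { replace ((x ^ 2 * (M * p n ^ 3)) ^ 2) with (x ^ 4 * M ^ 2 * (p n ^ 2) ^ 3) by ring.
    replace (C ^ 6 * W) with (x ^ 4 * M ^ 2 * (C ^ 2 * (L / M)) ^ 3)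
      by (unfold W; field; lra).
    apply Rmult_le_compat_l.
    - apply Rmult_le_pos; [lra|apply pow2_ge_0].
    - apply pow_incr; lra. }
  apply Rnot_le_lt; intro h.
  assert (eps ^ 2 <= (x ^ 2 * (M * p n ^ 3)) ^ 2) by (apply pow_incr; lra). lra.
- apply Rle_lt_trans with (C ^ 4 * W); [|exact W2].
  replace (M * (x * p n) ^ 4) with (x ^ 4 * M * (p n ^ 2) ^ 2) by ring.
  apply Rle_trans with (x ^ 4 * M * (C ^ 2 * (L / M)) ^ 2).
  + apply Rmult_le_compat_l; [apply Rmult_le_pos; lra|]. apply pow_incr; lra.
  + replace (x ^ 4 * M * (C ^ 2 * (L / M)) ^ 2) with (C ^ 4 * (x ^ 4 * L ^ 2 / M))
      by (field; lra).
    apply Rmult_le_compat_l; [lra|]. unfold W.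
    apply Rmult_le_compat_r; [left; apply Rinv_0_lt_compat; lra|].
    apply Rmult_le_compat_l; [lra|].
    assert (0 <= L ^ 2) by apply pow2_ge_0. simpl in *; nra.
Qed.

Lemma Un_cv_squeeze (u v x : nat -> R) (a : R) : Un_cv u a -> Un_cv v a ->
    (forall eps : R, 0 < eps -> exists N : nat, forall n : nat, (N <= n)%nat ->
      u n - eps <= x n <= v n + eps) ->
  Un_cv x a.
Proof.
intros hu hv hx eps e0.
destruct (hu (eps / 2)) as [N1 h1]; [lra|].
destruct (hv (eps / 2)) as [N2 h2]; [lra|].
destruct (hx (eps / 2)) as [N3 h3]; [lra|].
exists (N1 + N2 + N3)%nat; intros n hn.
specialize (h1 n ltac:(lia)); specialize (h2 n ltac:(lia)); specialize (h3 n ltac:(lia)).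
unfold Rdist in *; apply Rabs_def1; apply Rabs_def2 in h1; apply Rabs_def2 in h2; lra.
Qed.

Local Close Scope R_scope.

From HB Require Import structures.
From mathcomp Require Import all_boot all_fingroup.
From mathcomp Require Import all_order all_algebra ring lra Rstruct.
Import Order.TTheory GRing.Theory Num.Theory.

Set Implicit Arguments.
Unset Strict Implicit.
Unset Printing Implicit Defensive.
Local Open Scope ring_scope.

(** * Unions of independent random sets *)

Definition isotone (K : realFieldType) (T : finType) (F : {set T} -> K) :=
  forall G H : {set T}, G \subset H -> F G <= F H.

(** The mean of [F] at the union of [G] with those [c i] whose coin, of probability [b i], succeeds.
    [G] accumulates the sets already added, so that composing two such operators means taking an
    independent union. *)
Fixpoint runion (K : realFieldType) (T : finType) (I : Type) (b : I -> K)
    (c : I -> {set T}) (l : seq I) (F : {set T} -> K) (G : {set T}) : K :=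
  if l is i :: l' then
    b i * runion b c l' F (c i :|: G) + (1 - b i) * runion b c l' F G
  else F G.

Section RandomUnion.

Context {K : realFieldType} {T : finType}.
Implicit Types (F : {set T} -> K) (G H : {set T}).

Section Basics.
Context {I : Type}.
Implicit Types (b : I -> K) (c : I -> {set T}) (l : seq I).

Lemma runion_ext b c l F F' G : F =1 F' -> runion b c l F G = runion b c l F' G.
Proof. by move=> FF'; elim: l G => [|i l IH] G /=; rewrite ?FF' ?IH. Qed.

Lemma runion_eq_prob b b' c l F G :
  b =1 b' -> runion b c l F G = runion b' c l F G.
Proof. by move=> bb'; elim: l G => [|i l IH] G //=; rewrite bb' !IH. Qed.

Lemma runion_cat b c l l' F G :
  runion b c (l ++ l') F G = runion b c l (runion b c l' F) G.
Proof. by elim: l G => [|i l IH] G //=; rewrite !IH. Qed.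

Lemma runion_add b c l F F' G :
  runion b c l (fun H => F H + F' H) G = runion b c l F G + runion b c l F' G.
Proof. elim: l G => [|i l IH] G //=; rewrite !IH; ring. Qed.

Lemma runion_scale b c l a F G :
  runion b c l (fun H => a * F H) G = a * runion b c l F G.
Proof. elim: l G => [|i l IH] G //=; rewrite !IH; ring. Qed.

Lemma runion_cst b c l a G : runion b c l (fun=> a) G = a.
Proof. elim: l G => [|i l IH] G //=; rewrite !IH; ring. Qed.

Lemma runion_sub b c l F F' G :
  runion b c l (fun H => F H - F' H) G = runion b c l F G - runion b c l F' G.
Proof. elim: l G => [|i l IH] G //=; rewrite !IH; ring. Qed.

Lemma runion_sum (J : Type) (r : seq J) (P : pred J) (f : J -> {set T} -> K)
    b c l G :
  runion b c l (fun H => \sum_(j <- r | P j) f j H) G =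
  \sum_(j <- r | P j) runion b c l (f j) G.
Proof.
elim: r => [|j r IH].
  by rewrite big_nil -[RHS](runion_cst b c l 0 G); apply: runion_ext => H; rewrite big_nil.
rewrite big_cons -IH; case: ifP => Pj.
  by rewrite -runion_add; apply: runion_ext => H; rewrite big_cons Pj.
by apply: runion_ext => H; rewrite big_cons Pj.
Qed.

Lemma runion_shift b c l F G R :
  runion b c l (fun H => F (R :|: H)) G = runion b c l F (R :|: G).
Proof. by elim: l G => [|i l IH] G //=; rewrite !IH setUCA. Qed.

(** The comparison is asked only above [G] because sets only grow. The coupling relies on this: an
    accepted triangle stays accepted. *)
Lemma runion_le b c l F F' G : (forall i, 0 <= b i <= 1) ->
  (forall H, G \subset H -> F H <= F' H) -> runion b c l F G <= runion b c l F' G.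
Proof.
move=> b01; elim: l G => [|i l IH] G FF' /=; first exact: FF'.
have [b0 b1] := andP (b01 i).
apply: lerD; apply: ler_wpM2l; rewrite ?subr_ge0 //; apply: IH => H GH; apply: FF' => //.
exact: subset_trans (subsetUr _ _) GH.
Qed.

Lemma runion_ge0 b c l F G : (forall i, 0 <= b i <= 1) ->
  (forall H, 0 <= F H) -> 0 <= runion b c l F G.
Proof. by move=> b01 F0; rewrite -(runion_cst b c l 0 G); apply: runion_le. Qed.

Lemma runion_le1 b c l F G : (forall i, 0 <= b i <= 1) ->
  (forall H, F H <= 1) -> runion b c l F G <= 1.
Proof. by move=> b01 F0; rewrite -(runion_cst b c l 1 G); apply: runion_le. Qed.

Lemma runion_incr b c l F : (forall i, 0 <= b i <= 1) ->
  isotone F -> isotone (runion b c l F).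
Proof.
move=> b01 Fi; elim: l => [|i l IH] G H GH /=; first exact: Fi.
have [b0 b1] := andP (b01 i).
by apply: lerD; apply: ler_wpM2l; rewrite ?subr_ge0 //; apply: IH => //; apply: setUS.
Qed.

Lemma runion_le_prob b b' c l F G : (forall i, 0 <= b i <= 1) ->
    (forall i, b i <= b' i <= 1) -> isotone F ->
  runion b c l F G <= runion b' c l F G.
Proof.
move=> b01 bb' Fi; have b'01 i : 0 <= b' i <= 1.
  by have /andP[b0 _] := b01 i; have /andP[h ->] := bb' i; rewrite (le_trans b0 h).
elim: l G => [|i l IH] G //=.
have := IH (c i :|: G); have := IH G.
have : runion b' c l F G <= runion b' c l F (c i :|: G).
  by apply: runion_incr; rewrite ?subsetUr.
have := b01 i; have := bb' i; have := b'01 i.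
set x := runion _ _ _ _ _; set x' := runion _ _ _ _ _.
set y := runion _ _ _ _ _; set y' := runion _ _ _ _ _.
move=> /andP[b0' b1'] /andP[h _] /andP[b0 b1] xx' yx y'x'.
have h1 : b i * y' <= b i * x' by rewrite ler_wpM2l.
have h2 : (1 - b i) * y <= (1 - b i) * x by rewrite ler_wpM2l ?subr_ge0.
have h3 : 0 <= (b' i - b i) * (x' - x) by rewrite mulr_ge0 ?subr_ge0.
lra.
Qed.

(** Harris' inequality by induction on the coins: given the first one the induction hypothesis
    applies, and b (1 - b) (x' - x) (y' - y) >= 0 averages over it. *)
Lemma runion_harris b c l F F' G : (forall i, 0 <= b i <= 1) ->
    isotone F -> isotone F' ->
  runion b c l F G * runion b c l F' G <= runion b c l (fun H => F H * F' H) G.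
Proof.
move=> b01 Fi Fi'; elim: l G => [|i l IH] G //=.
have := IH (c i :|: G); have := IH G.
have : runion b c l F G <= runion b c l F (c i :|: G).
  by apply: runion_incr; rewrite ?subsetUr.
have : runion b c l F' G <= runion b c l F' (c i :|: G).
  by apply: runion_incr; rewrite ?subsetUr.
set x := runion _ _ _ _ _; set x' := runion _ _ _ _ _.
set y := runion _ _ _ _ _; set y' := runion _ _ _ _ _.
set z := runion _ _ _ _ _; set z' := runion _ _ _ _ _.
move=> xx' yy' hz hz'; have /andP[b0 b1] := b01 i.
have h1 : b i * (y' * x') <= b i * z' by rewrite ler_wpM2l.
have h2 : (1 - b i) * (y * x) <= (1 - b i) * z by rewrite ler_wpM2l ?subr_ge0.
have h3 : 0 <= (b i * (1 - b i)) * ((x' - x) * (y' - y)).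
  by rewrite !mulr_ge0 ?subr_ge0.
apply: le_trans (lerD h1 h2); rewrite -subr_ge0; apply: le_trans h3 _.
by rewrite le_eqVlt; apply/orP; left; apply/eqP; ring.
Qed.

End Basics.

Lemma runion_commute (I J : Type) (b : I -> K) (c : I -> {set T}) l
    (b' : J -> K) (c' : J -> {set T}) l' F G :
  runion b c l (runion b' c' l' F) G = runion b' c' l' (runion b c l F) G.
Proof.
elim: l G => [|i l IH] G //=; rewrite !IH -[runion _ _ _ _ (_ :|: G)]runion_shift.
by rewrite -!runion_scale -runion_add.
Qed.

(** Adding [c i] twice is adding it once, so [i] is absent exactly when both of its coins fail. *)
Lemma runion_merge (I : Type) (b b' : I -> K) (c : I -> {set T}) l F G :
  runion b c l (runion b' c l F) G =
  runion (fun i => 1 - (1 - b i) * (1 - b' i)) c l F G.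
Proof.
elim: l G => [|i l IH] G //=; rewrite -!IH.
have step H : runion b c l (fun G => b' i * runion b' c l F (c i :|: G) +
    (1 - b' i) * runion b' c l F G) H =
    b' i * runion b c l (runion b' c l F) (c i :|: H) +
    (1 - b' i) * runion b c l (runion b' c l F) H.
  by rewrite runion_add !runion_scale runion_shift.
rewrite !step setUA setUid; ring.
Qed.

Lemma runion_iter (I : Type) (b : I -> K) (c : I -> {set T}) l m F G :
  iter m (runion b c l) F G = runion (fun i => 1 - (1 - b i) ^+ m) c l F G.
Proof.
elim: m F G => [|m IH] F G.
  rewrite /= (@runion_eq_prob _ _ (fun=> 0)) => [|i]; last by rewrite expr0 subrr.
  by elim: l => //= i l ->; rewrite mul0r add0r subr0 mul1r.
rewrite iterS (runion_ext _ _ _ _ (IH F)) runion_merge.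
by apply: runion_eq_prob => i; rewrite subKr exprS.
Qed.

Lemma runion_morph (S : finType) (phi : {set S} -> {set T}) (I : Type)
    (b : I -> K) (c : I -> {set S}) l F (G : {set S}) :
    {morph phi : A B / A :|: B} ->
  runion b c l (F \o phi) G = runion b (phi \o c) l F (phi G).
Proof. by move=> phiU; elim: l G => [|i l IH] G //=; rewrite !IH phiU. Qed.

End RandomUnion.

(** * Random subsets with independent elements *)

Section RandomSubset.

Context {K : realFieldType} {T : finType}.
Implicit Types (F : {set T} -> K) (G H C : {set T}) (l : seq T).

Definition rsubset (q : K) l F G := runion (fun=> q) (fun x => [set x]) l F G.

Lemma rsubset_cons q x l F G :
  rsubset q (x :: l) F G = q * rsubset q l F (x |: G) + (1 - q) * rsubset q l F G.
Proof. by []. Qed.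

Lemma rsubset_shift q l F G R :
  rsubset q l (fun H => F (R :|: H)) G = rsubset q l F (R :|: G).
Proof. exact: runion_shift. Qed.

Lemma rsubset_notin q l F x G : x \notin l -> x \notin G ->
  rsubset q l (fun H => (x \in H)%:R * F H) G = 0.
Proof.
elim: l G => [|y l IH] G; first by move=> _ /negPf xG; rewrite /rsubset /= xG mul0r.
rewrite inE negb_or => /andP[xy xl] xG; rewrite rsubset_cons.
by rewrite !IH ?mulr0 ?addr0 // !inE negb_or xy.
Qed.

(** Conditioning on the presence of [C] costs one factor [q] per element and leaves the other coins
    untouched. On the right the elements of [C] are still drawn, but the union with [C] hides the
    outcome. Elements already in [G] would be free, hence the disjointness. *)
Lemma rsubset_subset q l F C G : uniq l -> {subset C <= l} -> [disjoint C & G] ->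
  rsubset q l (fun H => (C \subset H)%:R * F H) G =
  q ^+ #|C| * rsubset q l (fun H => F (C :|: H)) G.
Proof.
elim: l C G => [|x l IH] C G /= => [_ C0 _|/andP[xl ul] Cl dCG].
  have -> : C = set0 by apply/setP => y; rewrite inE; apply/negP => /C0.
  by rewrite cards0 expr0 mul1r /rsubset /= sub0set mul1r set0U.
rewrite !rsubset_cons.
have [xC|xC] := boolP (x \in C); last first.
  have Cl' : {subset C <= l}.
    by move=> y yC; have := Cl _ yC; rewrite inE => /predU1P[yx|//]; rewrite -yx yC in xC.
  rewrite !IH //; first ring.
  by rewrite -setI_eq0 setIUr setU_eq0 !setI_eq0 dCG andbT disjoint_sym disjoints1.
have xG : x \notin G by apply: contraTN dCG => xG; apply/pred0Pn; exists x; rewrite /= xC.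
set C' := C :\ x.
have CC' : C = x |: C' by rewrite setD1K.
have -> : rsubset q l (fun H => (C \subset H)%:R * F H) G = 0.
  rewrite -(rsubset_notin q (fun H => (C' \subset H)%:R * F H) xl xG).
  by apply: runion_ext => H; rewrite mulrA -natrM mulnb {1}CC' subUset sub1set.
have -> : rsubset q l (fun H => (C \subset H)%:R * F H) (x |: G) =
          rsubset q l (fun H => (C' \subset H)%:R * F H) (x |: G).
  rewrite -!rsubset_shift; apply: runion_ext => H; congr (_%:R * _).
  by rewrite {1}CC' subUset sub1set setU11.
rewrite IH //; last 2 first.
- move=> y; rewrite !inE => /andP[yx yC].
  by have := Cl _ yC; rewrite inE (negPf yx).
- rewrite -setI_eq0 setIUr setU_eq0 !setI_eq0 disjoint_sym disjoints1 !inE eqxx /=.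
  exact: disjointWl (subsetDl _ _) dCG.
have -> : rsubset q l (fun H => F (C :|: H)) (x |: G) =
    rsubset q l (fun H => F (C :|: H)) G.
  rewrite -rsubset_shift; apply: runion_ext => H.
  by rewrite /= setUA (@setUidPl _ C [set x] _) ?sub1set.
have -> : rsubset q l (fun H => F (C' :|: H)) (x |: G) =
    rsubset q l (fun H => F (C :|: H)) G.
  rewrite -rsubset_shift; apply: runion_ext => H.
  by rewrite setUCA setUA -CC'.
rewrite [#|C|](cardsD1 x) xC exprS; ring.
Qed.

Lemma rsubset_prob q l C : uniq l -> {subset C <= l} ->
  rsubset q l (fun H => (C \subset H)%:R) set0 = q ^+ #|C|.
Proof.
move=> ul Cl; transitivity (rsubset q l (fun H => (C \subset H)%:R * 1) set0).
  by apply: runion_ext => H; rewrite mulr1.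
rewrite (rsubset_subset q (fun=> 1)) // ?/rsubset ?runion_cst ?mulr1 //.
by rewrite -setI_eq0 setI0.
Qed.

Lemma rsubset_sum q l F : uniq l ->
  rsubset q l F set0 = \sum_(H : {set T} | H \subset [set x in l])
     q ^+ #|H| * (1 - q) ^+ (size l - #|H|) * F H.
Proof.
elim: l F => [|x l IH] F /=.
  move=> _; rewrite (big_pred1 set0) ?cards0 ?subn0 ?expr0 ?mul1r // => H.
  by rewrite /= -subset0; congr (_ \subset _); apply/setP => y; rewrite !inE.
move=> /andP[xl ul]; rewrite rsubset_cons.
have set_cons : [set y in x :: l] = x |: [set y in l].
  by apply/setP => y; rewrite !inE.
rewrite -rsubset_shift !IH // [RHS](bigID (fun H => x \in H)) /=.
congr (_ + _); rewrite big_distrr /=.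
  rewrite [RHS](reindex_onto (fun H => x |: H) (fun H => H :\ x)) /=; last first.
    by move=> H /andP[_ xH]; rewrite setD1K.
  apply: eq_big => [H|H Hl].
    rewrite set_cons setU11 andbT; apply/idP/idP => [Hl|/andP[h /eqP <-]].
      rewrite setUS //=; apply/eqP/setU1K; apply: contra xl => xH.
      by have := subsetP Hl _ xH; rewrite inE.
    apply/subsetP => y; rewrite !inE => /andP[yx].
    rewrite (negPf yx) /= => yH; have /subsetP/(_ y) := h.
    by rewrite !inE (negPf yx) yH; apply.
  have xH : x \notin H.
    by apply: contra xl => xH; have := subsetP Hl _ xH; rewrite inE.
  by rewrite cardsU1 xH add1n exprS subSS !mulrA.
apply: eq_big => [H|H Hl].
  rewrite set_cons; apply/idP/andP => [Hl|[Hl xH]].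
    split; first exact: subset_trans Hl (subsetUr _ _).
    by apply: contra xl => xH; have := subsetP Hl _ xH; rewrite inE.
  apply/subsetP => y yH; have := subsetP Hl _ yH; rewrite !inE => /predU1P[yx|//].
  by rewrite -yx yH in xH.
have Hs : (#|H| <= size l)%N.
  by rewrite (leq_trans (subset_leq_card Hl)) // cardsE card_size.
by rewrite subSn // exprS; ring.
Qed.

End RandomSubset.

(** * The sequential coupling *)

(** The Weierstrass product inequality; the induction also carries the upper bound 1 for the
    product. *)
Lemma prod_1B_ge (K : realFieldType) (I : Type) (r : seq I) (P : pred I) (a : I -> K) :
    (forall i, P i -> 0 <= a i <= 1) ->
  1 - \sum_(i <- r | P i) a i <= \prod_(i <- r | P i) (1 - a i).
Proof.
move=> a01; suff: 1 - \sum_(i <- r | P i) a i <= \prod_(i <- r | P i) (1 - a i) <= 1.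
  by case/andP.
elim: r => [|i r IH]; first by rewrite !big_nil subr0 lexx.
rewrite !big_cons; case: ifP => // Pi; have /andP[a0 a1] := a01 i Pi.
have P0 : 0 <= \prod_(i <- r | P i) (1 - a i).
  by apply: prodr_ge0 => j Pj; rewrite subr_ge0; case/andP: (a01 j Pj).
move: IH P0; set s := \sum_(_ <- _ | _) _; set t := \prod_(_ <- _ | _) _.
move=> /andP[st t1] t0.
have h1 : 0 <= a i * (1 - t) by rewrite mulr_ge0 // subr_ge0.
have h2 : 0 <= (1 - a i) * (1 - t) by rewrite mulr_ge0 // subr_ge0.
have h3 : 0 <= a i * t by rewrite mulr_ge0.
by apply/andP; split; lra.
Qed.

Lemma ler_sum_subset (K : realFieldType) (I : finType) (r1 r2 : seq I)
    (P1 P2 : pred I) (a : I -> K) :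
    uniq r1 -> uniq r2 -> (forall i, 0 <= a i) ->
    (forall i, i \in r1 -> P1 i -> (i \in r2) && P2 i) ->
  \sum_(i <- r1 | P1 i) a i <= \sum_(i <- r2 | P2 i) a i.
Proof.
move=> u1 u2 a0 sub12; rewrite -big_filter -[leRHS]big_filter.
rewrite big_uniq ?filter_uniq // [leRHS]big_uniq ?filter_uniq //=.
rewrite big_mkcond [leRHS]big_mkcond; apply: ler_sum => i _ /=.
rewrite !mem_filter; case: ifP => [/andP[Pi ri]|_]; last by case: ifP.
by rewrite andbC sub12.
Qed.

Section Coupling.

Context {K : realFieldType} {E J : finType}.
Variables (le : seq E) (lj : seq J) (C : J -> {set E}) (q pi : K).
Hypothesis le_uniq : uniq le.
Hypothesis lj_uniq : uniq lj.
Hypothesis C_sub : forall j, {subset C j <= le}.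
Hypothesis q01 : 0 <= q <= 1.
Hypothesis pi01 : 0 <= pi <= 1.

Implicit Types (H R : {set E}) (Y : {set J}) (no : seq (K * J)).

Let Ex (F : {set E} -> K) := rsubset q le F set0.

(* Relative weight of the edge sets [H], given that each tested triangle [j]
   was rejected with probability [rho] whenever contained in [H]. *)
Definition refused no H : K :=
  \prod_(x <- no) (1 - x.1 * (C x.2 \subset H)%:R).

Definition touch R i : pred J := fun j => ~~ [disjoint C j & C i :\: R].

Let prob_seq no := all (fun x : K * J => 0 <= x.1 <= 1) no.

Let indicator_bounds (x : K) (b : bool) : 0 <= x <= 1 -> 0 <= x * b%:R <= 1.
Proof. by case: b; rewrite ?mulr1 ?mulr0 // lexx ler01. Qed.

Lemma refused_bounds no H : prob_seq no -> 0 <= refused no H <= 1.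
Proof.
rewrite /refused; elim: no => [|x no IH] /=; first by rewrite big_nil ler01 lexx.
move=> /andP[x01 /IH/andP[p0 p1]]; rewrite big_cons.
have /andP[a0 a1] := indicator_bounds (C x.2 \subset H) x01.
by rewrite mulr_ge0 ?subr_ge0 //= mulr_ile1 ?subr_ge0 // gerBl.
Qed.

Lemma refused_anti no H H' : prob_seq no -> H \subset H' ->
  refused no H' <= refused no H.
Proof.
move=> no01 HH'; elim: no no01 => [|x no IH] /=; first by rewrite /refused !big_nil.
move=> /andP[x01 no01].
have := IH no01; have /andP[p0 p1] := refused_bounds H' no01.
rewrite /refused !big_cons -!/(refused no _) => le_no.
have /andP[a0 a1] := indicator_bounds (C x.2 \subset H') x01.
apply: ler_pM; rewrite ?subr_ge0 // lerD2l lerN2 ler_wpM2l //; first by case/andP: x01.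
rewrite ler_nat; case CH: (C x.2 \subset H) => //.
by rewrite (subset_trans CH HH').
Qed.

Lemma Ex_le F F' : (forall H, F H <= F' H) -> Ex F <= Ex F'.
Proof. by move=> FF'; apply: runion_le. Qed.

(* Harris: given [R] and the rejections, [C i] appears almost as if the
   rejections were absent, but for those touching a new edge of [C i]. *)
Lemma refused_harris R i no : prob_seq no ->
  Ex (fun H => refused no (R :|: H)) *
    (1 - \sum_(x <- no | touch R i x.2) q ^+ #|C x.2 :\: (R :|: C i)|) <=
  Ex (fun H => refused no (R :|: C i :|: H)).
Proof.
move=> no01; set U := R :|: C i; set s := \sum_(_ <- _ | _) _.
set no0 := [seq x <- no | ~~ touch R i x.2].
have no0_01 : prob_seq no0.
  by apply/allP => x; rewrite mem_filter => /andP[_] /(allP no01).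
have le_no0 H : refused no H <= refused no0 H.
  rewrite /refused big_filter (bigID (fun x => touch R i x.2)) /=.
  rewrite ler_piMl //.
    rewrite -big_filter; case/andP: (@refused_bounds no0 H no0_01) => + _.
    by rewrite /refused.
  rewrite -big_filter.
  have: prob_seq [seq x <- no | touch R i x.2].
    by apply/allP => x; rewrite mem_filter => /andP[_] /(allP no01).
  by move/(refused_bounds H)/andP=> [].
have no0_U H : refused no0 (U :|: H) = refused no0 (R :|: H).
  rewrite /refused !big_filter; apply: eq_bigr => x.
  rewrite /touch negbK => dC; congr (1 - _ * _%:R); congr (nat_of_bool _).
  apply/idP/idP => [|h]; last by apply: subset_trans h _; rewrite setSU // subsetUl.
  move=> /subsetP CU; apply/subsetP => y yC; have := CU y yC; rewrite !inE.
  case yR: (y \in R) => //=; case yCi: (y \in C i) => //= _.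
  by have /pred0P/(_ y) := dC; rewrite /= yC !inE yR yCi.
pose D H := refused no0 (U :|: H).
have D0 : 0 <= Ex D by apply: runion_ge0 => // H; case/andP: (refused_bounds (U :|: H) no0_01).
(* Harris for an increasing event and the decreasing [D]; the sign changes in [e1] and [e2] make
   both functions isotone. *)
have step x : Ex (fun H => (C x.2 \subset U :|: H)%:R * D H) <=
    q ^+ #|C x.2 :\: U| * Ex D :> K.
  have e1 : Ex (fun H => (C x.2 \subset U :|: H)%:R * D H) =
            - Ex (fun H => (C x.2 :\: U \subset H)%:R * - D H).
    rewrite -mulN1r -[in RHS]/(rsubset _ _ _ _) -runion_scale.
    by apply: runion_ext => H; rewrite subDset mulN1r mulrN opprK.
  have e2 : Ex D = - Ex (fun H => - D H).
    rewrite -mulN1r -[in RHS]/(rsubset _ _ _ _) -runion_scale.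
    by apply: runion_ext => H; rewrite mulN1r opprK.
  rewrite e1 e2 mulrN lerN2 -(@rsubset_prob _ _ q le) //; last first.
    by move=> y; rewrite inE => /andP[_] /C_sub.
  apply: runion_harris => //.
    move=> G H GH; rewrite ler_nat; case CG: (_ \subset G) => //.
    by rewrite (subset_trans CG GH).
  by move=> G H GH; rewrite lerN2; apply: refused_anti; rewrite ?setUS.
have le1 : Ex (fun H => refused no (R :|: H)) <= Ex D.
  by apply: Ex_le => H; rewrite /D no0_U; apply: le_no0.
have le2 : Ex D * (1 - s) <= Ex (fun H => refused no (U :|: H)).
  rewrite mulrBr mulr1; apply: le_trans (_ : Ex D -
    \sum_(x <- no | touch R i x.2) Ex (fun H => (C x.2 \subset U :|: H)%:R * D H) <= _).
    rewrite lerD2l lerN2 mulr_sumr; apply: ler_sum => x _; rewrite mulrC; exact: step.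
  rewrite -[X in _ - X]/(\sum_(x <- no | _) runion _ _ _ _ _) -runion_sum -runion_sub.
  apply: Ex_le => H; rewrite -mulr_suml -{1}[D H]mul1r -mulrBl.
  rewrite /D /refused big_filter [leRHS](bigID (fun x => touch R i x.2)) /=; apply: ler_wpM2r.
    rewrite -big_filter -/(refused no0 _).
    by case/andP: (refused_bounds (U :|: H) no0_01).
  rewrite -big_filter -[in leRHS]big_filter.
  apply: le_trans (_ : 1 - \sum_(x <- [seq x <- no | touch R i x.2])
     x.1 * (C x.2 \subset U :|: H)%:R <= _).
    rewrite lerD2l lerN2 big_seq [leRHS]big_seq; apply: ler_sum => x.
    rewrite mem_filter => /andP[_ /(allP no01)/andP[_ x1]].
    by rewrite ler_piMl ?ler0n.
  rewrite big_seq [leRHS]big_seq; apply: prod_1B_ge => x.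
  by rewrite mem_filter => /andP[_ /(allP no01)] /indicator_bounds.
have [s1|s1] := lerP 0 (1 - s); first by apply: le_trans le2; rewrite ler_wpM2r.
apply: le_trans (_ : 0 <= _).
  rewrite mulr_ge0_le0 ?(ltW s1) //; apply: runion_ge0 => // H.
  by case/andP: (refused_bounds (R :|: H) no01).
by apply: runion_ge0 => // H; case/andP: (refused_bounds (U :|: H) no01).
Qed.

Definition cover_of Y : {set E} := \bigcup_(j in Y) C j.

(** The expected number of further triangles sharing a new edge with [i], once the edges of [Y] and
    of [i] are present; it bounds the sum in [refused_harris]. All triangles outside [Y] are
    counted, rejected or not, so being bad depends on the accepted family and not on the history. *)
Definition load Y i : K :=
  \sum_(j <- lj | [&& j != i, j \notin Y & touch (cover_of Y) i j])
     q ^+ #|C j :\: (cover_of Y :|: C i)|.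

Variables (g : {set E} -> K) (Z : {set J} -> K) (kap : nat).
Hypothesis g_isotone : isotone g.
Hypothesis g01 : forall H, 0 <= g H <= 1.
Hypothesis C_card : forall j, j \in lj -> (#|C j| <= kap)%N.
Hypothesis Z0 : 0 <= Z set0.
Hypothesis Z_isotone : isotone Z.
Hypothesis Z_bad : forall Y i, i \notin Y -> i \in lj -> {subset Y <= lj} ->
  q ^+ kap * (1 - load Y i) < pi -> Z Y + 1 <= Z (i |: Y).

Let h Y := g (cover_of Y) - Z Y.

(** Here [Y] holds the accepted triangles, [no] the rejected ones with their coins, [l] those to
    come; a bad triangle is skipped and enters neither [Y] nor [no]. Divided by the weight of the
    history, the claim bounds the conditional mean of [g] from below by the mean of [g] on the final
    cover minus the growth of [Z], with [l] decided by independent coins [pi]. *)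
Lemma coupling_step no Y l :
    uniq (l ++ map snd no) -> {subset l ++ map snd no <= lj} ->
    {subset Y <= lj} -> (forall j, j \in l ++ map snd no -> j \notin Y) ->
    prob_seq no ->
  Ex (fun H => refused no (cover_of Y :|: H)) * (rsubset pi l h Y + Z Y) <=
  Ex (fun H => refused no (cover_of Y :|: H) * g (cover_of Y :|: H)).
Proof.
elim: l no Y => [|i l IH] no Y ul llj Ylj lY no01.
  rewrite /rsubset /= /h subrK /Ex /rsubset mulrC -runion_scale.
  apply: Ex_le => H; rewrite mulrC ler_wpM2l ?g_isotone ?subsetUl //.
  by case/andP: (refused_bounds (cover_of Y :|: H) no01).
set R := cover_of Y; set M := Ex _; set G := Ex _.
have M0 : 0 <= M.
  by apply: runion_ge0 => // H; case/andP: (refused_bounds (R :|: H) no01).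
have [i_no ul'] : i \notin l ++ map snd no /\ uniq (l ++ map snd no).
  exact/andP.
have [pi0 pi1] := andP pi01.
have iY : i \notin Y by apply: lY; rewrite mem_head.
have ilj : i \in lj by apply: llj; rewrite mem_head.
have lY' j : j \in l ++ map snd no -> j \notin Y by move=> jl; apply: lY; rewrite inE jl orbT.
have llj' : {subset l ++ map snd no <= lj} by move=> j jl; apply: llj; rewrite inE jl orbT.
have iYlj : {subset i |: Y <= lj} by move=> j; rewrite !inE => /predU1P[->|/Ylj].
have iYl j : j \in l ++ map snd no -> j \notin i |: Y.
  move=> jl; rewrite !inE negb_or lY' // andbT; apply: contraNneq i_no => <-//.
have covU : cover_of (i |: Y) = R :|: C i by rewrite /cover_of big_setU1 //= setUC.
have IHno := IH no Y ul' llj' Ylj lY' no01.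
have Zi : Z Y <= Z (i |: Y) by apply: Z_isotone; apply: subsetUr.
rewrite rsubset_cons; set hi := rsubset pi l h (i |: Y); set hY := rsubset pi l h Y.
rewrite -/R -/M -/G -/hY in IHno.
(* In the bad case nothing is tested. Accepting [i] raises [Z] by at least 1, hence by at least [g],
   so this branch contributes at most 0; the other one is the induction hypothesis with the same
   history. *)
have [bad|good] := ltP (q ^+ kap * (1 - load Y i)) pi.
  have hi0 : hi + Z Y <= 0.
    apply: le_trans (_ : rsubset pi l (fun=> - Z Y) (i |: Y) + Z Y <= 0); last first.
      by rewrite /rsubset runion_cst addNr.
    rewrite lerD2r; apply: runion_le => // H YH.
    have := Z_bad iY ilj Ylj bad; have := Z_isotone YH.
    by rewrite /h; have := g01 (cover_of H); lra.
  have G0 : 0 <= G.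
    apply: runion_ge0 => // H; rewrite mulr_ge0 //.
      by case/andP: (refused_bounds (R :|: H) no01).
    by case/andP: (g01 (R :|: H)).
  have h1 : 0 <= pi * M * - (hi + Z Y) by rewrite !mulr_ge0 // oppr_ge0.
  have h2 : (1 - pi) * (M * (hY + Z Y)) <= (1 - pi) * G.
    by rewrite ler_wpM2l // subr_ge0.
  have h3 : 0 <= pi * G by rewrite mulr_ge0.
  by lra.
set q' := q ^+ #|C i :\: R|; set M' := Ex (fun H => refused no (R :|: C i :|: H)).
have M'0 : 0 <= M'.
  by apply: runion_ge0 => // H; case/andP: (refused_bounds (R :|: C i :|: H) no01).
have [q0 q1] := andP q01.
(* Given the history, all of [C i] is present with conditional probability q' M' / M, so the claim
   is that this is at least [pi]. *)
have key : pi * M <= q' * M'.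
  have h1 := refused_harris R i no01.
  set s := \sum_(_ <- _ | _) _ in h1.
  have sl : s <= load Y i.
    rewrite /s /load -(big_map snd (touch R i) (fun j => q ^+ #|C j :\: (R :|: C i)|)).
    apply: ler_sum_subset => // [|j|j jno tj].
    - by move: ul'; rewrite cat_uniq => /and3P[].
    - by rewrite exprn_ge0.
    have jl : j \in l ++ map snd no by rewrite mem_cat jno orbT.
    rewrite llj' // lY' // tj !andbT.
    by case: eqP => // ji; rewrite -ji jl in i_no.
  have q'k : q ^+ kap <= q'.
    apply: ler_wiXn2l => //; apply: leq_trans (C_card ilj).
    exact: subset_leq_card (subsetDl _ _).
  have k0 : 0 <= q ^+ kap by rewrite exprn_ge0.
  have h2 : q' * (M * (1 - s)) <= q' * M' by rewrite ler_wpM2l ?exprn_ge0.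
  have h3 : 0 <= q' * M * (load Y i - s).
    by rewrite !mulr_ge0 ?subr_ge0 ?exprn_ge0.
  have [l1|l1] := lerP 0 (1 - load Y i).
    have h4 : 0 <= M * (1 - load Y i) * (q' - q ^+ kap).
      by rewrite mulr_ge0 ?subr_ge0 ?mulr_ge0.
    have h5 : 0 <= M * (q ^+ kap * (1 - load Y i) - pi).
      by rewrite mulr_ge0 ?subr_ge0 ?mulr_ge0.
    lra.
  (* With a load above 1, a good step is possible only for pi = 0. *)
  have h4 : q ^+ kap * (1 - load Y i) <= 0 by rewrite mulr_ge0_le0 // ltW.
  have -> : pi = 0 by apply/eqP; rewrite eq_le pi0 (le_trans good h4).
  by rewrite mul0r !mulr_ge0 ?exprn_ge0.
have qM'0 : 0 <= q' * M' by rewrite mulr_ge0 ?exprn_ge0.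
(* Thinning: [i] is accepted if [C i] is present and an extra coin [rho] succeeds, which brings the
   conditional probability down to exactly [pi]. If q' M' = 0, then pi M = 0 as well and rho = 0
   serves. *)
have [rho /andP[rho0 rho1] rhoE] : exists2 rho, 0 <= rho <= 1 & rho * (q' * M') = pi * M.
  have [z|nz] := eqVneq (q' * M') 0.
    exists 0; rewrite ?lexx ?ler01 //; rewrite mul0r; apply/eqP.
    by rewrite eq_le -{2}z key mulr_ge0.
  exists (pi * M / (q' * M')); last by rewrite divfK.
  have pM0 : 0 <= pi * M by apply: mulr_ge0.
  by rewrite divr_ge0 //= ler_pdivrMr ?mul1r // lt_def nz.
have no01' : prob_seq ((rho, i) :: no) by rewrite /= rho0 rho1.
have refE H : refused ((rho, i) :: no) H =
    refused no H - rho * ((C i \subset H)%:R * refused no H).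
  by rewrite /refused big_cons /= -/(refused no H); ring.
have exi (F : {set E} -> K) :
    Ex (fun H => (C i \subset R :|: H)%:R * F (R :|: H)) =
    q' * Ex (fun H => F (R :|: C i :|: H)).
  transitivity (Ex (fun H => (C i :\: R \subset H)%:R * F (R :|: H))).
    by apply: runion_ext => H; rewrite subDset.
  rewrite /Ex (rsubset_subset q (fun H => F (R :|: H))) //.
  - congr (_ * _); apply: runion_ext => H; congr F.
    by apply/setP => x; rewrite !inE; case: (x \in R).
  - by move=> x; rewrite inE => /andP[_] /C_sub.
  - by rewrite -setI_eq0 setI0.
have uno : uniq (l ++ map snd ((rho, i) :: no)).
  by rewrite /= -[i :: _]cat1s uniq_catCA.
have memno : l ++ map snd ((rho, i) :: no) =i (i :: l) ++ map snd no.
  by move=> j; rewrite /= !(mem_cat, inE); case: (j == i); rewrite ?orbT.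
have IHn := IH ((rho, i) :: no) Y uno _ Ylj _ no01'.
have {}IHn := IHn (fun j jl => llj j (etrans (esym (memno j)) jl))
  (fun j jl => lY j (etrans (esym (memno j)) jl)).
have IHy := IH no (i |: Y) ul' llj' iYlj iYl no01.
rewrite covU -/M' -/hi in IHy; rewrite -/R -/hY in IHn.
have eM : Ex (fun H => refused ((rho, i) :: no) (R :|: H)) = (1 - pi) * M.
  transitivity (Ex (fun H => refused no (R :|: H) -
      rho * ((C i \subset R :|: H)%:R * refused no (R :|: H)))).
    by apply: runion_ext => H; apply: refE.
  rewrite /Ex /rsubset runion_sub runion_scale -!/(rsubset _ _ _ _) -!/(Ex _).
  by rewrite (exi (refused no)) -/M' rhoE -/M; ring.
pose G' := Ex (fun H => refused no (R :|: C i :|: H) * g (R :|: C i :|: H)).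
have eG : Ex (fun H => refused ((rho, i) :: no) (R :|: H) * g (R :|: H)) =
    G - rho * q' * G'.
  transitivity (Ex (fun H => refused no (R :|: H) * g (R :|: H) -
    rho * ((C i \subset R :|: H)%:R * (refused no (R :|: H) * g (R :|: H))))).
    by apply: runion_ext => H; rewrite refE; ring.
  rewrite /Ex /rsubset runion_sub runion_scale -!/(rsubset _ _ _ _) -!/(Ex _).
  by rewrite (exi (fun H => refused no H * g H)) mulrA.
rewrite eM eG in IHn.
rewrite -/G' in IHy.
have h1 : 0 <= rho * q' * (G' - M' * (hi + Z (i |: Y))).
  by rewrite !mulr_ge0 ?subr_ge0 ?exprn_ge0.
have h2 : 0 <= pi * M * (Z (i |: Y) - Z Y) by rewrite !mulr_ge0 ?subr_ge0.
have h3 : rho * q' * (M' * (hi + Z (i |: Y))) = pi * M * (hi + Z (i |: Y)).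
  by rewrite -rhoE; ring.
lra.
Qed.

(** The empty history. By linearity the correction [Z] moves to the right-hand side as a mean over
    independent triangles. *)
Theorem rsubset_coupling :
  rsubset pi lj (g \o cover_of) set0 <=
  rsubset q le g set0 + rsubset pi lj Z set0.
Proof.
have := @coupling_step [::] set0 lj; rewrite /= cats0 lj_uniq.
have cov0 : cover_of set0 = set0 by rewrite /cover_of big_set0.
have e1 F : Ex (fun H => refused [::] (cover_of set0 :|: H) * F (cover_of set0 :|: H)) = Ex F.
  by apply: runion_ext => H; rewrite /refused big_nil cov0 set0U mul1r.
have e2 : Ex (fun H => refused [::] (cover_of set0 :|: H)) = 1.
  rewrite -[RHS](runion_cst (fun=> q) (fun x => [set x]) le 1 set0).
  by apply: runion_ext => H; rewrite /refused big_nil.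
rewrite e1 e2 mul1r => key.
have {key} := key isT (fun j jl => jl) _ _ isT.
have in0 j : j \in set0 -> j \in lj by rewrite inE.
have notin0 j : j \in lj -> j \notin (set0 : {set J}) by rewrite inE.
move=> /(_ in0 notin0).
rewrite /h [rsubset pi lj (fun _ => _) _]runion_sub -!/(rsubset _ _ _ _).
have := Z0.
rewrite /Ex; lra.
Qed.

End Coupling.

(** * Counting bad configurations of triangles *)

Definition clique n (S : {set 'I_n}) : {set 'I_n * 'I_n} :=
  [set x | [&& x.1 != x.2, x.1 \in S & x.2 \in S]].

Definition ksubsets n k : seq {set 'I_n} := enum [set S : {set 'I_n} | #|S| == k].

(** Edges as 2-sets, each carrying a single coin, whereas graphs consist of ordered pairs; the
    coupling runs on 2-sets and [edge_union] translates. *)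
Definition pairs_in n (S : {set 'I_n}) : {set {set 'I_n}} :=
  [set e : {set 'I_n} | e \subset S & #|e| == 2].

Arguments clique {n} S.
Arguments pairs_in {n} S.

Section Triangles.

Context {n : nat}.
Implicit Types (i y : {set 'I_n}) (u v x : 'I_n).

Lemma mem_ksubsets k (S : {set 'I_n}) : (S \in ksubsets n k) = (#|S| == k).
Proof. by rewrite mem_enum inE. Qed.

Lemma ksubsets_uniq k : uniq (ksubsets n k).
Proof. exact: enum_uniq. Qed.

Lemma set3E (S : {set 'I_n}) u v x : #|S| = 3 ->
  u \in S -> v \in S -> x \in S -> u != v -> x != u -> x != v -> S = [set u; v; x].
Proof.
move=> S3 uS vS xS uv xu xv; apply/esym/eqP; rewrite eqEcard S3; apply/andP; split.
  by apply/subsetP => z; rewrite !inE => /orP[/orP[]|] /eqP->.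
by rewrite setUC cardsU1 cards2 !inE negb_or xu xv uv.
Qed.

Lemma card_triples_through u v : u != v ->
  (#|[set S : {set 'I_n} | [&& #|S| == 3, u \in S & v \in S]]| <= n)%N.
Proof.
move=> uv; rewrite -[X in (_ <= X)%N]card_ord -cardsT.
apply: leq_trans (leq_imset_card (fun x => [set u; v; x]) _).
apply/subset_leq_card/subsetP => S; rewrite inE => /and3P[/eqP S3 uS vS].
have /set0Pn[x] : S :\: [set u; v] != set0.
  rewrite -card_gt0 cardsD S3; rewrite (leq_trans _ (leq_sub2l 3 (subset_leq_card (subsetIr _ _)))) //.
  by rewrite cards2 uv.
rewrite !inE negb_or => /andP[/andP[xu xv] xS].
by apply/imsetP; exists x; rewrite ?inE //; apply: set3E.
Qed.

Lemma card_triples : (#|[set S : {set 'I_n} | #|S| == 3]| <= n ^ 3)%N.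
Proof.
rewrite card_draws card_ord -(leq_pmul2r (fact_gt0 3)) bin_ffact.
rewrite !ffactnS ffactn0 muln1 (_ : 3`! = 6)%N //.
apply: leq_trans (_ : n * (n * n) <= _)%N; last by rewrite !expnS expn0 muln1 leq_pmulr.
by rewrite !leq_mul ?leq_pred // (leq_trans (leq_pred _)) ?leq_pred.
Qed.

(* [t = (u, v, x)] : the triangle on [u], [v], [x] shares with [i] exactly the
   edge [uv]. *)
Definition ear i (t : 'I_n * 'I_n * 'I_n) :=
  [&& t.1.1 \in i, t.1.2 \in i, t.1.1 != t.1.2 & t.2 \notin i].

(** Closed ears: [y] covers the edge [ux] and [y'] the edge [vx], so the triangle [uvx] appears
    without having been accepted. *)
Definition ears2 i y y' : {set 'I_n * 'I_n * 'I_n} :=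
  [set t | [&& ear i t, t.1.1 \in y, t.2 \in y, t.1.2 \in y' & t.2 \in y']].

(** Half-open ears: [y] covers [ux] or [vx]. *)
Definition ears1 i y : {set 'I_n * 'I_n * 'I_n} :=
  [set t | [&& ear i t, (t.1.1 \in y) || (t.1.2 \in y) & t.2 \in y]].

Lemma card_ears i : #|i| = 3 -> (#|[set t | ear i t]| <= 9 * n)%N.
Proof.
move=> i3; apply: leq_trans (_ : #|setX (setX i i) [set: 'I_n]| <= _)%N.
  apply/subset_leq_card/subsetP => -[[u v] x]; rewrite !inE /ear /= => /and4P[-> -> _ _].
  by [].
by rewrite !cardsX i3 cardsT card_ord.
Qed.

Lemma card_ears1 i y : #|i| = 3 -> #|y| = 3 -> (#|ears1 i y| <= 27)%N.
Proof.
move=> i3 y3; apply: leq_trans (_ : #|setX (setX i i) y| <= _)%N.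
  apply/subset_leq_card/subsetP => -[[u v] x].
  by rewrite !inE /ear /= => /and3P[/and4P[-> -> _ _] _ ->].
by rewrite !cardsX i3 y3.
Qed.

Lemma card_sum_exchange (I J : finType) (P : pred I) (R : I -> pred J) :
  (\sum_(i | P i) #|[set j | R i j]| = \sum_(j : J) #|[set i | P i && R i j]|)%N.
Proof.
under eq_bigr => i _ do rewrite -sum1dep_card big_mkcond.
rewrite exchange_big /=; apply: eq_bigr => j _.
rewrite -sum1dep_card big_mkcond [RHS]big_mkcond /=.
by apply: eq_bigr => i _; case: (P i).
Qed.

(** There are at most 9 n ears at [i], and at most 2 n triangles contain [ux] or [vx]. *)
Lemma sum_ears1 i : #|i| = 3 ->
  (\sum_(y : {set 'I_n} | #|y| == 3) #|ears1 i y| <= 18 * n ^ 2)%N.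
Proof.
move=> i3; rewrite card_sum_exchange /=.
apply: leq_trans (_ : \sum_(t in [set t | ear i t]) 2 * n <= _)%N.
  rewrite [leqRHS]big_mkcond; apply: leq_sum => -[[u v] x] _; rewrite inE.
  rewrite /ear /=; case: ifP => [/and4P[ui vi uv xi]|nE]; last first.
    by rewrite leqn0 cards_eq0; apply/eqP/setP => y; rewrite !inE /= andbF.
  have ux : u != x by apply: contraNneq xi => <-.
  have vx : v != x by apply: contraNneq xi => <-.
  have -> : (2 * n = n + n)%N by rewrite mul2n addnn.
  apply: leq_trans (leq_add (card_triples_through ux) (card_triples_through vx)).
  apply: leq_trans (leq_card_setU _ _).
  apply/subset_leq_card/subsetP => y; rewrite !inE /= => /and3P[-> uvy ->].
  by case/orP: uvy => ->; rewrite ?orbT.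
rewrite sum_nat_const; apply: leq_trans (leq_mul (card_ears i3) (leqnn _)) _.
by rewrite mulnACA -mulnn.
Qed.

(** At most n^3 choices of [u], [v], [x], then one free vertex in each of [i], [y], [y']. *)
Lemma sum_ears2 :
  (\sum_(i : {set 'I_n} | #|i| == 3) \sum_(y : {set 'I_n} | #|y| == 3)
     \sum_(y' : {set 'I_n} | #|y'| == 3) #|ears2 i y y'| <= n ^ 6)%N.
Proof.
pose T3 u v := [set S : {set 'I_n} | [&& #|S| == 3, u \in S & v \in S]].
pose D (t : 'I_n * 'I_n * 'I_n) := [&& t.1.1 != t.1.2, t.1.1 != t.2 & t.1.2 != t.2].
have bound i y y' (t : 'I_n * 'I_n * 'I_n) : #|i| == 3 -> #|y| == 3 -> #|y'| == 3 ->
   (t \in ears2 i y y' <= D t * (i \in T3 t.1.1 t.1.2) * (y \in T3 t.1.1 t.2) *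
    (y' \in T3 t.1.2 t.2))%N.
  move=> i3 y3 y'3; case: t => [[u v] x]; rewrite !inE /ear /D /= i3 y3 y'3 /=.
  case: (boolP (u \in i)) => //= ui; case: (boolP (v \in i)) => //= vi.
  case: (boolP (x \in i)) => //= xi; rewrite ?andbF //.
  have -> : u != x by apply: contraNneq xi => <-.
  have -> : v != x by apply: contraNneq xi => <-.
  by case: (u != v) (u \in y) (x \in y) (v \in y') (x \in y') => [] [] [] [] [].
apply: leq_trans (_ : \sum_(t : 'I_n * 'I_n * 'I_n)
    D t * #|T3 t.1.1 t.1.2| * #|T3 t.1.1 t.2| * #|T3 t.1.2 t.2| <= _)%N.
  apply: leq_trans (_ : \sum_(i : {set 'I_n}) \sum_(y : {set 'I_n})
     \sum_(y' : {set 'I_n}) \sum_(t : 'I_n * 'I_n * 'I_n)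
       (D t * (i \in T3 t.1.1 t.1.2) * (y \in T3 t.1.1 t.2) * (y' \in T3 t.1.2 t.2)) <= _)%N.
    rewrite big_mkcond; apply: leq_sum => i _; case: ifP => // i3.
    rewrite big_mkcond; apply: leq_sum => y _; case: ifP => // y3.
    rewrite big_mkcond; apply: leq_sum => y' _; case: ifP => // y'3.
    rewrite -sum1_card big_mkcond; apply: leq_sum => t _.
    by have := bound i y y' t i3 y3 y'3; case: (t \in _).
  under eq_bigr => i _ do under eq_bigr => y _ do rewrite exchange_big.
  under eq_bigr => i _ do rewrite exchange_big.
  rewrite exchange_big; apply: leq_sum => t _ /=.
  have cE u v : (\sum_(i : {set 'I_n}) (i \in T3 u v) = #|T3 u v|)%N.
    by rewrite -sum1_card [RHS]big_mkcond.
  under eq_bigr => i _ do under eq_bigr => y _ do rewrite -big_distrr /= cE.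
  under eq_bigr => i _ do rewrite -big_distrl -big_distrr /= cE.
  by rewrite -!big_distrl -big_distrr /= cE.
apply: leq_trans (_ : \sum_(t : 'I_n * 'I_n * 'I_n) n * n * n <= _)%N.
  apply: leq_sum => -[[u v] x] _; rewrite /D /=.
  case: (boolP (u != v)) => //= uv; case: (boolP (u != x)) => //= ux.
  case: (boolP (v != x)) => //= vx.
  by rewrite mul1n !leq_mul ?card_triples_through.
by rewrite sum_nat_const !card_prod card_ord !expnS expn0 muln1 !mulnA.
Qed.

End Triangles.

(** * The load of a new triangle in terms of ears *)

Section Load.

Context {K : realFieldType} {n : nat}.
Variable q : K.
Hypothesis q01 : 0 <= q <= 1.
Implicit Types (i y : {set 'I_n}) (Y : {set {set 'I_n}}).

Let triangle (t : 'I_n * 'I_n * 'I_n) : {set 'I_n} := [set t.1.1; t.1.2; t.2].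

Lemma touch_ear i (j : {set 'I_n}) R : #|i| = 3 -> #|j| = 3 -> j != i -> touch pairs_in R i j ->
  exists2 t, ear i t & triangle t = j.
Proof.
move=> i3 j3 ji /pred0Pn[e /=]; rewrite !inE => /andP[/andP[ej e2] /andP[_ /andP[ei _]]].
have /cards2P[u [v [uv eE]]] := e2; subst e.
have [[uj vj] [ui vi]] : (u \in j /\ v \in j) /\ (u \in i /\ v \in i).
  by do 2 split; apply: (subsetP ej) || apply: (subsetP ei); rewrite !inE eqxx ?orbT.
have /set0Pn[x] : j :\: [set u; v] != set0.
  by rewrite -card_gt0 cardsD (setIidPr ej) j3 cards2 uv.
rewrite !inE negb_or => /andP[/andP[xu xv] xj].
have jE := set3E j3 uj vj xj uv xu xv.
exists (u, v, x); last by rewrite jE.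
rewrite /ear /= ui vi uv /=; apply: contra ji => xi.
by rewrite jE (set3E i3 ui vi xi uv xu xv).
Qed.

Let N2 Y i t : nat := (\sum_(y in Y) \sum_(y' in Y | y' != y) (t \in ears2 i y y'))%N.
Let N1 Y i t : nat := (\sum_(y in Y) (t \in ears1 i y))%N.

(** The cases are the number of edges among [ux], [vx] covered by [Y]. If both are, the two covering
    triangles differ, since a common one would be [uvx] itself, and [N2] is at least 1. If one is,
    the other still costs [q]; if none is, two edges are missing. *)
Lemma ear_weight Y i t : ear i t -> triangle t \notin Y ->
    (forall y, y \in Y -> #|y| = 3) ->
  q ^+ #|pairs_in (triangle t) :\: (cover_of pairs_in Y :|: pairs_in i)| <=
  (N2 Y i t)%:R + q * (N1 Y i t)%:R + q ^+ 2.
Proof.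
have [q0 q1] := andP q01.
case: t => [[u v] x] et tY Y3; have := et; rewrite /ear /= => /and4P[ui vi uv xi].
have ux : u != x by apply: contraNneq xi => <-.
have vx : v != x by apply: contraNneq xi => <-.
set R := cover_of _ _; set D := _ :\: _.
have pair_in w : w \in [set u; v] -> [set w; x] \notin R -> [set w; x] \in D.
  move=> wuv wR; rewrite !inE (negPf wR) /= cards2.
  have -> : w != x by move: wuv; rewrite !inE => /orP[]/eqP->.
  rewrite !andbT; apply/andP; split.
    by apply: contra xi => /subsetP/(_ x); rewrite !inE eqxx orbT; apply.
  by apply/subsetP => z; move: wuv; rewrite !inE => /orP[]/eqP-> /orP[]/eqP->; rewrite eqxx ?orbT.
have pair_R w : w \in [set u; v] -> [set w; x] \in R ->
    exists2 y, y \in Y & (w \in y) && (x \in y).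
  move=> _ /bigcupP[y yY]; rewrite inE => /andP[/subsetP wxy _]; exists y => //.
  by rewrite !wxy // !inE eqxx ?orbT.
have u_uv : u \in [set u; v] by rewrite !inE eqxx.
have v_uv : v \in [set u; v] by rewrite !inE eqxx orbT.
have N2_ge0 : 0 <= (N2 Y i (u, v, x))%:R :> K by [].
have N1_ge0 : 0 <= q * (N1 Y i (u, v, x))%:R :> K by rewrite mulr_ge0.
have N1P y : y \in Y -> (u \in y) || (v \in y) -> x \in y ->
    q <= q * (N1 Y i (u, v, x))%:R.
  move=> yY uvy xy; rewrite ler_peMr // (ler_nat _ 1) /N1 (bigD1 y) //=.
  by rewrite inE et /= uvy xy.
have q2 : 0 <= q ^+ 2 by rewrite exprn_ge0.
have D1 w : w \in [set u; v] -> [set w; x] \notin R -> q ^+ #|D| <= q.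
  move=> wuv wR; rewrite -[leRHS]expr1; apply: ler_wiXn2l => //.
  by rewrite card_gt0; apply/set0Pn; exists [set w; x]; apply: pair_in.
have [uR|uR] := boolP ([set u; x] \in R); have [vR|vR] := boolP ([set v; x] \in R).
- have [y yY /andP[uy xy]] := pair_R u u_uv uR.
  have [y' y'Y /andP[vy' xy']] := pair_R v v_uv vR.
  have y'y : y' != y.
    apply: contraNneq tY => y'y; rewrite y'y in vy'.
    by rewrite /triangle /= -(set3E (Y3 _ yY) uy vy' xy) // eq_sym.
  have N2_ge1 : 1 <= (N2 Y i (u, v, x))%:R :> K.
    rewrite (ler_nat _ 1) /N2 (bigD1 y) //= (bigD1 y') /=; last by rewrite y'Y.
    by rewrite inE et /= uy xy vy' xy'.
  rewrite -addrA; apply: ler_wpDr; first exact: addr_ge0.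
  by apply: le_trans N2_ge1; rewrite exprn_ile1.
- have [y yY /andP[uy xy]] := pair_R u u_uv uR.
  apply: ler_wpDr => //; apply: ler_wpDl => //.
  by apply: le_trans (D1 v v_uv vR) (N1P y yY _ xy); rewrite uy.
- have [y yY /andP[vy xy]] := pair_R v v_uv vR.
  apply: ler_wpDr => //; apply: ler_wpDl => //.
  by apply: le_trans (D1 u u_uv uR) (N1P y yY _ xy); rewrite vy orbT.
apply: ler_wpDl; first exact: addr_ge0.
apply: ler_wiXn2l => //; apply: leq_trans (_ : #|[set [set u; x]; [set v; x]]| <= _)%N.
    rewrite cards2 (_ : _ != _) //; apply/eqP => /setP/(_ u).
    by rewrite !inE eqxx (negPf uv) (negPf ux).
  by apply/subset_leq_card/subsetP => e; rewrite !inE => /orP[]/eqP->;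
    have := pair_in u u_uv uR; have := pair_in v v_uv vR; rewrite !inE.
Qed.

Lemma load_le Y i : #|i| = 3 -> (forall y, y \in Y -> #|y| = 3) ->
  load (ksubsets n 3) pairs_in q Y i <=
  (\sum_(y in Y) \sum_(y' in Y | y' != y) #|ears2 i y y'|)%:R +
  q * (\sum_(y in Y) #|ears1 i y|)%:R + (9 * n)%:R * q ^+ 2.
Proof.
move=> i3 Y3; have [q0 q1] := andP q01.
rewrite /load big_enum_cond /=.
pose w (j : {set 'I_n}) :=
  q ^+ #|pairs_in j :\: (cover_of pairs_in Y :|: pairs_in i)|.
pose cond (j : {set 'I_n}) := (j \in [set S : {set 'I_n} | #|S| == 3]) &&
  [&& j != i, j \notin Y & touch pairs_in (cover_of pairs_in Y) i j].
rewrite -[leLHS]/(\sum_(j | cond j) w j).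
apply: le_trans (_ : \sum_(j | cond j) \sum_(t | ear i t && (triangle t == j)) w j <= _).
  apply: ler_sum => j /andP[]; rewrite inE => /eqP j3 /and3P[ji _ tj].
  have [t et <-] := touch_ear i3 j3 ji tj.
  rewrite (bigD1 t) ?et ?eqxx //= lerDl; apply: sumr_ge0 => *; exact: exprn_ge0.
rewrite (exchange_big_dep (ear i)) /=; last by move=> j t _ /andP[].
apply: le_trans (_ : \sum_(t | ear i t)
   ((N2 Y i t)%:R + q * (N1 Y i t)%:R + q ^+ 2) <= _).
  apply: ler_sum => t et.
  have [ct|/negPf nct] := boolP (cond (triangle t)); last first.
    rewrite big_pred0; last by move=> j; rewrite et; case: eqP => [<-|]; rewrite ?nct ?andbF.
    by rewrite !addr_ge0 ?mulr_ge0 ?exprn_ge0.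
  rewrite (big_pred1 (triangle t)); last first.
    by move=> j /=; rewrite et eq_sym; case: eqP => [->|]; rewrite ?ct ?andbF.
  by apply: ear_weight => //; case/andP: ct => _ /and3P[].
have card_earsE (S : {set 'I_n * 'I_n * 'I_n}) : S \subset [set t | ear i t] ->
    (\sum_(t | ear i t) (t \in S) = #|S|)%N.
  move=> /subsetP SE; rewrite -sum1_card [RHS]big_mkcond [LHS]big_mkcond /=.
  by apply: eq_bigr => t _; case: ifP => // nE; case: ifP => // /SE; rewrite inE nE.
rewrite !big_split /= -mulr_sumr -!natr_sum sumr_const.
apply: lerD; first apply: lerD.
- rewrite ler_nat /N2 exchange_big /=; apply: leq_sum => y _.
  rewrite exchange_big /=; apply: leq_sum => y' _; rewrite card_earsE //.
  by apply/subsetP => t; rewrite !inE => /and5P[].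
- rewrite ler_wpM2l // ler_nat /N1 exchange_big /=; apply: leq_sum => y _.
  by rewrite card_earsE //; apply/subsetP => t; rewrite !inE => /and3P[].
rewrite -[leLHS]mulr_natl ler_wpM2r ?exprn_ge0 // ler_nat.
by have := card_ears i3; rewrite cardsE.
Qed.

End Load.

(** * The function counting bad configurations, and its mean *)

Section BadCount.

Context {K : realFieldType} {n : nat}.
Variables q pi : K.
Hypothesis q01 : 0 <= q <= 1.
Hypothesis pi01 : 0 <= pi <= 1.
Hypothesis pi_q : 1000 * pi <= q ^+ 3.
Hypothesis q_small : 90 * (n%:R * q ^+ 2) <= 1.
Implicit Types (i y : {set 'I_n}) (Y T : {set {set 'I_n}}).

Let T3 : pred {set 'I_n} := fun S => #|S| == 3.

(* The weights are such that [2.5 a + 6.25 b ^ 2 >= 1] as soon as [a + b >= 0.8]: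
   here [a] counts closed ears and [b] is [q] times the number of half-open ones,
   whose second moment is needed since its first moment does not vanish. *)
Definition bad_weight i y y' : K :=
  5 / 2 * ((y' != y) * #|ears2 i y y'|)%:R +
  25 / 4 * q ^+ 2 * (#|ears1 i y| * #|ears1 i y'|)%:R.

(** Every accepted triangle is allowed as the centre [i], whatever the order of acceptance; this
    makes the count an increasing function of the family alone. *)
Definition bad_count T : K :=
  \sum_(i | T3 i) \sum_(y | T3 y && (y != i)) \sum_(y' | T3 y' && (y' != i))
    bad_weight i y y' * ([set i; y; y'] \subset T)%:R.

Let q2_ge0 : 0 <= q ^+ 2. Proof. by case/andP: q01 => q0 _; rewrite exprn_ge0. Qed.

Lemma bad_weight_ge0 i y y' : 0 <= bad_weight i y y'.
Proof.
apply: addr_ge0; apply: mulr_ge0 => //; first by rewrite divr_ge0.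
by apply: mulr_ge0 => //; rewrite divr_ge0.
Qed.

Lemma bad_count_ge0 T : 0 <= bad_count T.
Proof.
by do 3 (apply: sumr_ge0 => ? _); rewrite mulr_ge0 ?bad_weight_ge0.
Qed.

Lemma bad_count_isotone : isotone bad_count.
Proof.
move=> T T' TT'; do 3 (apply: ler_sum => ? _); rewrite ler_wpM2l ?bad_weight_ge0 //.
by rewrite ler_nat; case S: (_ \subset T) => //; rewrite (subset_trans S TT').
Qed.

Lemma bad_count_bad Y i : i \notin Y -> i \in ksubsets n 3 ->
    {subset Y <= ksubsets n 3} ->
    q ^+ 3 * (1 - load (ksubsets n 3) pairs_in q Y i) < pi ->
  bad_count Y + 1 <= bad_count (i |: Y).
Proof.
move=> iY; rewrite mem_ksubsets => i3 Ysub bad.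
have Y3 y : y \in Y -> #|y| = 3 by move/Ysub; rewrite mem_ksubsets => /eqP.
have [q0 q1] := andP q01; have [pi0 pi1] := andP pi01.
set a := (\sum_(y in Y) \sum_(y' in Y | y' != y) #|ears2 i y y'|)%N.
set b := (\sum_(y in Y) #|ears1 i y|)%N.
(* A bad step has load at least 0.999 because 1000 pi <= q^3, and the term 9 n q^2 of [load_le] is
   at most 0.1. *)
have ab : 8 / 10 <= a%:R + q * b%:R.
  have q3 : 0 <= q ^+ 3 by rewrite exprn_ge0.
  have l1 : 999 / 1000 <= load (ksubsets n 3) pairs_in q Y i.
    rewrite leNgt; apply/negP => l1.
    have h : 0 <= q ^+ 3 * (999 / 1000 - load (ksubsets n 3) pairs_in q Y i).
      by rewrite mulr_ge0 // subr_ge0 ltW.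
    by move: h bad pi_q; move: (q ^+ 3) (load _ _ _ _ _) => x l; lra.
  have := load_le q01 (eqP i3) Y3; rewrite -/a -/b natrM.
  move: l1 q_small; move: (load _ _ _ _ _) (a%:R) (q * b%:R) => l A B.
  by move: (n%:R) (q ^+ 2) => N Q; lra.
have sumE : \sum_(y in Y) \sum_(y' in Y) bad_weight i y y' =
    5 / 2 * a%:R + 25 / 4 * (q * b%:R) ^+ 2.
  rewrite /bad_weight; under eq_bigr => y _ do rewrite big_split /=.
  rewrite big_split /=; congr (_ + _).
    rewrite /a natr_sum mulr_sumr; apply: eq_bigr => y _.
    rewrite natr_sum mulr_sumr [RHS]big_mkcondr /=; apply: eq_bigr => y' _.
    by case: (y' != y); rewrite ?mul1n ?mul0n ?mulr0.
  have -> : 25 / 4 * (q * b%:R) ^+ 2 = 25 / 4 * q ^+ 2 * (b * b)%:R.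
    by rewrite natrM; ring.
  rewrite /b big_distrl natr_sum mulr_sumr /=.
  apply: eq_bigr => y _; by rewrite big_distrr natr_sum mulr_sumr.
have sum_ge1 : 1 <= \sum_(y in Y) \sum_(y' in Y) bad_weight i y y'.
  rewrite sumE; move: ab (ler0n K a) (mulr_ge0 q0 (ler0n K b)).
  move: (a%:R) (q * b%:R) => A B ab A0 B0.
  (* The tangent at 0.4 gives 6.25 B^2 >= 5 B - 1, and 2.5 A + 5 B - 1 >= 2.5 (A + B) - 1 >= 1. *)
  have : 0 <= (B - 4 / 10) ^+ 2 by rewrite sqr_ge0.
  by rewrite !expr2; lra.
pose inner j T := \sum_(y | T3 y && (y != j)) \sum_(y' | T3 y' && (y' != j))
  bad_weight j y y' * ([set j; y; y'] \subset T)%:R.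
(* The terms centred at [i] vanish before its acceptance and include all pairs from [Y] afterwards;
   the other centres can only gain. *)
have inner0 : inner i Y = 0.
  apply: big1 => y _; apply: big1 => y' _.
  case: (boolP (_ \subset Y)) => [/subsetP/(_ i)|]; last by rewrite mulr0.
  by rewrite !inE eqxx /= (negPf iY) => /(_ isT).
have T3Y y : y \in Y -> T3 y && (y != i).
  by move=> yY; rewrite /T3 Y3 //=; apply: contraNneq iY => <-.
have inner1 : 1 <= inner i (i |: Y).
  apply: le_trans sum_ge1 _; rewrite /inner big_mkcond [leRHS]big_mkcond /=.
  apply: ler_sum => y _; case: ifP => [yY|_]; last first.
    by case: ifP => // _; apply: sumr_ge0 => y' _; rewrite mulr_ge0 ?bad_weight_ge0.
  rewrite T3Y // big_mkcond [leRHS]big_mkcond /=; apply: ler_sum => y' _.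
  case: ifP => [y'Y|_]; last by case: ifP => // _; rewrite mulr_ge0 ?bad_weight_ge0.
  rewrite T3Y // (_ : _ \subset _) ?mulr1 //.
  by apply/subsetP => j; rewrite !inE => /orP[/orP[]|] /eqP->; rewrite ?eqxx ?yY ?y'Y ?orbT.
have rest : \sum_(j | T3 j && (j != i)) inner j Y <=
            \sum_(j | T3 j && (j != i)) inner j (i |: Y).
  do 3 (apply: ler_sum => ? _); rewrite ler_wpM2l ?bad_weight_ge0 // ler_nat.
  by case S: (_ \subset Y) => //; rewrite (subset_trans S (subsetUr _ _)).
rewrite /bad_count (bigD1 i) //= [leRHS](bigD1 i) //= -!/(inner _ _) inner0 add0r addrC.
exact: lerD.
Qed.

Let sum_lin3 (P : pred {set 'I_n}) (f1 f2 f3 : {set 'I_n} -> nat) (c1 c2 c3 : K) :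
  \sum_(y | P y) (c1 * (f1 y)%:R + c2 * (f2 y)%:R + c3 * (f3 y)%:R) =
  c1 * (\sum_(y | P y) f1 y)%:R + c2 * (\sum_(y | P y) f2 y)%:R +
  c3 * (\sum_(y | P y) f3 y)%:R.
Proof. by rewrite !big_split /= -!mulr_sumr -!natr_sum. Qed.

(** The set of [i], [y], [y'] has three elements except for y = y', where only pi^2 is available and
    only [ears1] contributes. The constants are 25/4 times 18^2, and 25/4 times 27 times 18 rounded
    up. *)
Lemma bad_count_mean :
  rsubset pi (ksubsets n 3) bad_count set0 <=
  5 / 2 * n%:R ^+ 6 * pi ^+ 3 +
  q ^+ 2 * (2025 * n%:R ^+ 7 * pi ^+ 3 + 3038 * n%:R ^+ 5 * pi ^+ 2).
Proof.
have [q0 q1] := andP q01; have [pi0 pi1] := andP pi01.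
set c2 := 25 / 4 * q ^+ 2 * pi ^+ 3; set c3 := 25 / 4 * q ^+ 2 * pi ^+ 2.
have pi2 : 0 <= pi ^+ 2 by rewrite exprn_ge0.
have pi3 : 0 <= pi ^+ 3 by rewrite exprn_ge0.
have c1_ge0 : 0 <= 5 / 2 * pi ^+ 3 by rewrite mulr_ge0 ?divr_ge0.
have c4_ge0 : 0 <= 25 / 4 * q ^+ 2 by rewrite mulr_ge0 ?divr_ge0.
have c2_ge0 : 0 <= c2 by rewrite mulr_ge0.
have c3_ge0 : 0 <= c3 by rewrite mulr_ge0.
pose term i y y' : K := 5 / 2 * pi ^+ 3 * (#|ears2 i y y'|)%:R +
  c2 * (#|ears1 i y| * #|ears1 i y'|)%:R +
  c3 * ((y' == y) * (#|ears1 i y| * #|ears1 i y'|))%:R.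
have term_ge0 i y y' : 0 <= term i y y' by apply: addr_ge0; last exact: mulr_ge0; apply: addr_ge0; exact: mulr_ge0.
apply: le_trans (_ : \sum_(i | T3 i) \sum_(y | T3 y) \sum_(y' | T3 y') term i y y' <= _).
  rewrite /rsubset runion_sum; apply: ler_sum => i i3.
  rewrite runion_sum big_mkcondr /=; apply: ler_sum => y y3; case: ifP => [yi|_]; last first.
    by apply: sumr_ge0 => y' _.
  rewrite runion_sum big_mkcondr /=; apply: ler_sum => y' y'3; case: ifP => [y'i|_]; last first.
    by [].
  rewrite runion_scale [X in _ * X]rsubset_prob ?ksubsets_uniq //; last first.
    by move=> j; rewrite !inE mem_ksubsets => /orP[/orP[]|] /eqP->.
  rewrite /bad_weight /term /c2 /c3 setUC cardsU1 cards2 !inE negb_or y'i [i == y]eq_sym yi /=.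
  case: eqP => [->|_] /=.
    rewrite !mul0n !mul1n mulr0 add0r mulrAC -/c3; apply: ler_wpDl => //.
    by apply: addr_ge0; exact: mulr_ge0.
  rewrite mul1n mul0n mulr0 addr0 le_eqVlt; apply/orP; left; apply/eqP; ring.
under eq_bigr => i _ do under eq_bigr => y _ do rewrite sum_lin3.
under eq_bigr => i _ do rewrite sum_lin3.
rewrite sum_lin3.
set A := (\sum_(i | _) _)%N; set B := (\sum_(i | _) _)%N; set C := (\sum_(i | _) _)%N.
have A_le : (A <= n ^ 6)%N by apply: sum_ears2.
have B_le : (B <= n ^ 3 * ((18 * n ^ 2) * (18 * n ^ 2)))%N.
  apply: leq_trans (_ : \sum_(i | T3 i) (18 * n ^ 2) * (18 * n ^ 2) <= _)%N.
    apply: leq_sum => i /eqP i3; have h := sum_ears1 i3.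
    under eq_bigr => y _ do rewrite -big_distrr /=.
    by rewrite -big_distrl /= leq_mul.
  by rewrite sum_nat_const leq_mul2r -cardsE card_triples orbT.
have C_le : (C <= n ^ 3 * (27 * (18 * n ^ 2)))%N.
  apply: leq_trans (_ : \sum_(i | T3 i) 27 * (18 * n ^ 2) <= _)%N.
    apply: leq_sum => i /eqP i3; apply: leq_trans (leq_mul (leqnn _) (sum_ears1 i3)).
    rewrite big_distrr /=; apply: leq_sum => y /eqP y3.
    rewrite (bigD1 y) ?/T3 ?y3 //= eqxx mul1n big1 => [|y' /andP[_ /negPf->]]; last by rewrite mul0n.
    by rewrite addn0 leq_mul2r card_ears1 ?orbT.
  by rewrite sum_nat_const leq_mul2r -cardsE card_triples orbT.
set N : K := n%:R.
have ha : A%:R <= N ^+ 6 by rewrite -natrX ler_nat.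
have hb : B%:R <= N ^+ 3 * (18 * N ^+ 2 * (18 * N ^+ 2)) by rewrite -!natrX -!natrM ler_nat.
have hc : C%:R <= N ^+ 3 * (27 * (18 * N ^+ 2)) by rewrite -!natrX -!natrM ler_nat.
move: (A%:R) (B%:R) (C%:R) ha hb hc => a b c ha hb hc.
have h1 := ler_wpM2l c1_ge0 ha; have h2 := ler_wpM2l c2_ge0 hb; have h3 := ler_wpM2l c3_ge0 hc.
apply: le_trans (lerD (lerD h1 h2) h3) _.
have h : 0 <= q ^+ 2 * (N ^+ 5 * pi ^+ 2) by rewrite mulr_ge0 // mulr_ge0 ?exprn_ge0.
rewrite /c2 /c3; lra.
Qed.

End BadCount.

(** * Comparison of the two models *)

Section Comparison.

Context {K : realFieldType} {n : nat}.
Implicit Types (F : {set 'I_n * 'I_n} -> K) (G : {set 'I_n * 'I_n}).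

Definition edge_union (H : {set {set 'I_n}}) : {set 'I_n * 'I_n} := \bigcup_(e in H) clique e.

Lemma edge_unionU : {morph edge_union : A B / A :|: B}.
Proof. by move=> A B; apply: bigcup_setU. Qed.

Lemma edge_union0 : edge_union set0 = set0.
Proof. by rewrite /edge_union big_set0. Qed.

Lemma edge_union1 e : edge_union [set e] = clique e.
Proof. by rewrite /edge_union big_set1. Qed.

Lemma edge_union_pairs (S : {set 'I_n}) : edge_union (pairs_in S) = clique S.
Proof.
apply/setP => -[u v]; rewrite inE /=; apply/bigcupP/and3P => [[e]|[uv uS vS]].
  by rewrite !inE /= => /andP[/subsetP eS _] /and3P[uv /eS uS /eS vS].
exists [set u; v]; rewrite !inE /= ?eqxx ?orbT ?andbT ?uv //.
rewrite cards2 uv eqxx andbT; apply/subsetP => w.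
by rewrite !inE => /orP[]/eqP->.
Qed.

Lemma edge_union_cover (Y : {set {set 'I_n}}) :
  edge_union (cover_of pairs_in Y) = edge_union Y.
Proof.
apply/setP => x; apply/bigcupP/bigcupP => [[e /bigcupP[y yY ey] xe]|[y yY]].
  by exists y => //; rewrite -edge_union_pairs; apply/bigcupP; exists e.
rewrite -edge_union_pairs => /bigcupP[e ey xe]; exists e => //.
by apply/bigcupP; exists y.
Qed.

Lemma rsubset_cliques (q : K) (l : seq {set 'I_n}) F :
  rsubset q l (F \o edge_union) set0 = runion (fun=> q) clique l F set0.
Proof.
rewrite /rsubset (runion_morph _ _ _ _ _ edge_unionU) edge_union0.
by elim: l set0 => //= S l IH G; rewrite !IH edge_union1.
Qed.

Lemma triangles_le_edges (q pi : K) F :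
    0 <= q <= 1 -> 0 <= pi <= 1 -> 1000 * pi <= q ^+ 3 ->
    90 * (n%:R * q ^+ 2) <= 1 -> isotone F -> (forall G, 0 <= F G <= 1) ->
  runion (fun=> pi) clique (ksubsets n 3) F set0 <=
  runion (fun=> q) clique (ksubsets n 2) F set0 +
  (5 / 2 * n%:R ^+ 6 * pi ^+ 3 +
   q ^+ 2 * (2025 * n%:R ^+ 7 * pi ^+ 3 + 3038 * n%:R ^+ 5 * pi ^+ 2)).
Proof.
move=> q01 pi01 pi_q q_small Fi F01.
have Fui : isotone (F \o edge_union).
  move=> A B AB; apply: Fi; apply/subsetP => x /bigcupP[e eA xe].
  by apply/bigcupP; exists e => //; apply: (subsetP AB).
have pairs_le (j : {set 'I_n}) : {subset pairs_in j <= ksubsets n 2}.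
  by move=> e; rewrite inE mem_ksubsets => /andP[].
have pairs_card j : j \in ksubsets n 3 -> (#|pairs_in j| <= 3)%N.
  by rewrite mem_ksubsets => /eqP j3; rewrite /pairs_in cards_draws j3.
have := rsubset_coupling (ksubsets_uniq 2) (ksubsets_uniq 3) pairs_le q01 pi01 Fui
  (fun H => F01 (edge_union H)) pairs_card (bad_count_ge0 q01 set0)
  (bad_count_isotone q01) (bad_count_bad q01 pi01 pi_q q_small).
have -> : rsubset pi (ksubsets n 3) ((F \o edge_union) \o cover_of pairs_in) set0 =
    runion (fun=> pi) clique (ksubsets n 3) F set0.
  by rewrite -rsubset_cliques; apply: runion_ext => Y /=; rewrite edge_union_cover.
rewrite rsubset_cliques => h; apply: le_trans h _; rewrite lerD2l.
exact: bad_count_mean.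
Qed.

End Comparison.

(** Only the outcomes with at most one success are kept; [r i] is at most the odds of [b i]. *)
Lemma runion_ge_first_order (K : realFieldType) (T : finType) (I : Type)
    (b r : I -> K) (c : I -> {set T}) (l : seq I) (F : {set T} -> K) (G : {set T}) :
    (forall i, 0 <= b i <= 1) -> (forall i, 0 <= r i) ->
    (forall i, r i * (1 - b i) <= b i) -> (forall H, 0 <= F H) ->
  \prod_(i <- l) (1 - b i) * (F G + \sum_(i <- l) r i * F (c i :|: G)) <=
  runion b c l F G.
Proof.
move=> b01 r0 rb F0; elim: l G => [|i l IH] G.
  by rewrite !big_nil mul1r addr0.
rewrite !big_cons /=; have := IH (c i :|: G); have := IH G.
have P0 : 0 <= \prod_(i <- l) (1 - b i).
  by apply: prodr_ge0 => j _; rewrite subr_ge0; case/andP: (b01 j).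
have S0 : 0 <= \sum_(j <- l) r j * F (c j :|: (c i :|: G)).
  by apply: sumr_ge0 => j _; rewrite mulr_ge0.
move: P0 S0 (b01 i) (rb i) (F0 (c i :|: G)).
set P := \prod_(_ <- _) _; set S := \sum_(_ <- _) _; set S' := \sum_(_ <- _) _.
set x := runion _ _ _ _ _; set y := runion _ _ _ _ _.
move: (F G) (F (c i :|: G)) => f f' P0 S'0 /andP[b0 b1] rbi f'0 hx hy.
have h1 : 0 <= b i * (y - P * (f' + S)) by rewrite mulr_ge0 // subr_ge0.
have h2 : 0 <= (1 - b i) * (x - P * (f + S')) by rewrite mulr_ge0 ?subr_ge0.
have h3 : 0 <= b i * (P * S) by rewrite !mulr_ge0.
have h4 : 0 <= (b i - r i * (1 - b i)) * (P * f').
  by rewrite mulr_ge0 ?mulr_ge0 ?subr_ge0.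
lra.
Qed.

Lemma runion_eq_prob_in (K : realFieldType) (T : finType) (I : eqType)
    (b b' : I -> K) (c : I -> {set T}) l F G :
  {in l, b =1 b'} -> runion b c l F G = runion b' c l F G.
Proof.
elim: l G => [|i l IH] G //= bb'; rewrite bb' ?mem_head ?IH // => j jl;
  by rewrite bb' // inE jl orbT.
Qed.

Lemma ffact_le_expn n k : (n ^_ k <= n ^ k)%N.
Proof. by elim: k => // k IH; rewrite ffactnSr expnSr leq_mul ?leq_subr. Qed.

Lemma bin_le_expn n k : ('C(n, k) <= n ^ k)%N.
Proof.
apply: leq_trans (ffact_le_expn n k); rewrite -bin_ffact leq_pmulr //.
exact: fact_gt0.
Qed.

(** * Exchanging an object for independent cliques *)

Section Objects.

Context {K : realFieldType} {n : nat}.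
Variable p : K.
Hypothesis p01 : 0 <= p <= 1.
Implicit Types (F : {set 'I_n * 'I_n} -> K) (G : {set 'I_n * 'I_n}).

Definition object_step F G : K :=
  rsubset p (enum 'I_n) (fun S => F (clique S :|: G)) set0.

Definition subset_prob (k : nat) : K := p ^+ k * (1 - p) ^+ (n - k).

Let r (S : {set 'I_n}) := subset_prob #|S|.

Let r_ge0 S : 0 <= r S.
Proof.
by case/andP: p01 => p0 p1; rewrite mulr_ge0 ?exprn_ge0 ?subr_ge0.
Qed.

Let rsubsetE (F : {set 'I_n} -> K) :
  rsubset p (enum 'I_n) F set0 = \sum_(S : {set 'I_n}) r S * F S.
Proof.
rewrite rsubset_sum ?enum_uniq // size_enum_ord; apply: eq_bigl => S.
by apply/subsetP => x _; rewrite inE mem_enum.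
Qed.

(** Union bound over the k-subsets that [S] contains. *)
Lemma card_tail k :
  \sum_(S : {set 'I_n} | (k <= #|S|)%N) r S <= (n%:R * p) ^+ k.
Proof.
have [p0 p1] := andP p01.
apply: le_trans (_ : \sum_(Q in [set Q : {set 'I_n} | #|Q| == k]) p ^+ k <= _).
  apply: le_trans (_ : \sum_(Q in [set Q : {set 'I_n} | #|Q| == k])
      \sum_(S : {set 'I_n}) r S * (Q \subset S)%:R <= _).
    rewrite exchange_big big_mkcond; apply: ler_sum => S _ /=; case: ifP => [kS|_]; last first.
      by apply: sumr_ge0 => Q _; rewrite mulr_ge0.
    have [Q QS Qk] : exists2 Q : {set 'I_n}, Q \subset S & #|Q| == k.
      have /card_gt0P[Q] : (0 < #|[set Q : {set 'I_n} | Q \subset S & #|Q| == k]|)%N.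
        by rewrite cards_draws bin_gt0.
      by rewrite inE => /andP[QS Qk]; exists Q.
    rewrite (bigD1 Q) ?inE //= QS mulr1 lerDl.
    by apply: sumr_ge0 => Q' _; rewrite mulr_ge0.
  apply: ler_sum => Q; rewrite inE => /eqP Qk; rewrite -rsubsetE rsubset_prob ?Qk ?enum_uniq //.
  by move=> x _; rewrite mem_enum.
rewrite sumr_const card_draws card_ord exprMn -[leLHS]mulr_natl -natrX.
by rewrite ler_wpM2r ?exprn_ge0 // ler_nat bin_le_expn.
Qed.

Lemma object_step_le F F' G : (forall G, F G <= F' G) ->
  object_step F G <= object_step F' G.
Proof. by move=> FF'; apply: runion_le. Qed.

Lemma object_step_add_cst F a G :
  object_step (fun H => F H + a) G = object_step F G + a.
Proof.
rewrite /object_step /rsubset runion_add; congr (_ + _); exact: runion_cst.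
Qed.

Lemma object_step_compl F G :
  object_step (fun H => 1 - F H) G = 1 - object_step F G.
Proof.
rewrite /object_step /rsubset runion_sub; congr (_ - _); exact: runion_cst.
Qed.

Variable beta : nat -> K.
Hypothesis beta01 : forall k, 0 <= beta k <= 1.
Hypothesis beta_le : forall k, beta k <= subset_prob k.
Hypothesis beta_ge : forall k, subset_prob k * (1 - beta k) <= beta k.

Let l := ksubsets n 2 ++ ksubsets n 3.

Let b (S : {set 'I_n}) := beta #|S|.

(** Sets of size 0 or 1 create no edge, and sizes from 4 on cost (n p)^4. What remains is (1 - s) F
    G + t, while the independent cliques give at least (1 - s) (F G + t); the gap s t is again at
    most (n p)^4. As [F] is any function into [0,1], the reverse bound comes from [1 - F]. *)
Lemma object_step_approx F G : (forall G, 0 <= F G <= 1) ->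
  object_step F G <= runion b clique l F G + 2 * (n%:R * p) ^+ 4.
Proof.
move=> F01; have F0 H : 0 <= F H by case/andP: (F01 H).
have F1 H : F H <= 1 by case/andP: (F01 H).
set s := \sum_(S <- l) r S; set t := \sum_(S <- l) r S * F (clique S :|: G).
have sumlE (f : {set 'I_n} -> K) :
    \sum_(S <- l) f S = \sum_(S : {set 'I_n} | (2 <= #|S| < 4)%N) f S.
  rewrite /l big_cat /= !big_enum /= [RHS](bigID (fun S : {set 'I_n} => #|S| == 2)%N) /=.
  by congr (_ + _); apply: eq_bigl => S; rewrite inE;
     case: #|S| => [|[|[|[|k]]]] //=; rewrite ?andbF.
have tail4 := card_tail 4.
have s_le : s <= (n%:R * p) ^+ 2.
  apply: le_trans (card_tail 2); rewrite /s sumlE big_mkcond [leRHS]big_mkcond /=.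
  apply: ler_sum => S _; case: ifP => [/andP[-> _]//|_]; by case: ifP.
have s0 : 0 <= s by apply: sumr_ge0.
have t0 : 0 <= t by apply: sumr_ge0 => S _; rewrite mulr_ge0.
have ts : t <= s by apply: ler_sum => S _; rewrite ler_piMr.
have total : \sum_(S : {set 'I_n}) r S = 1.
  transitivity (rsubset p (enum 'I_n) (fun=> 1 : K) set0); last exact: runion_cst.
  by rewrite rsubsetE; apply: eq_bigr => S _; rewrite mulr1.
set x := \sum_(S : {set 'I_n} | (4 <= #|S|)%N) r S in tail4.
have x0 : 0 <= x by apply: sumr_ge0.
have up : object_step F G <= (1 - s) * F G + t + x.
  rewrite /object_step rsubsetE (bigID (fun S : {set 'I_n} => 2 <= #|S| < 4)%N) /=.
  rewrite -sumlE -/t [X in _ + X](bigID (fun S : {set 'I_n} => 4 <= #|S|)%N) /=.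
  set X := \sum_(_ | _) _; set X' := \sum_(_ | _) _.
  have X_le : X <= x.
    rewrite /X /x big_mkcond [leRHS]big_mkcond /=; apply: ler_sum => S _.
    case: ifP => [/andP[_ ->]|_]; last by case: ifP.
    by rewrite ler_piMr.
  have X'_le : X' <= (1 - s) * F G.
    rewrite (_ : X' = \sum_(S : {set 'I_n} | (#|S| < 2)%N) r S * F G).
      rewrite -mulr_suml ler_wpM2r // -total.
      rewrite lerBrDr /s sumlE [leRHS](bigID (fun S : {set 'I_n} => 2 <= #|S| < 4)%N) /=.
      rewrite [leLHS]addrC lerD2l big_mkcond [leRHS]big_mkcond /=; apply: ler_sum => S _.
      by move: (r S) (r_ge0 S) => a a0; case: #|S| => [|[|[|[|k]]]].
    rewrite /X'; apply: eq_big => [S|S]; first by case: #|S| => [|[|[|[|k]]]].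
    move=> S4; have S1 : (#|S| <= 1)%N by move: S4; case: #|S| => [|[|[|[|k]]]].
    rewrite (_ : clique S = set0) ?set0U //; apply/setP => -[u v]; rewrite !inE /=.
    by apply/negP => /and3P[uv uS vS]; rewrite (card_le1_eqP S1 _ _ uS vS) eqxx in uv.
  by lra.
have low : (1 - s) * (F G + t) <= runion b clique l F G.
  have := @runion_ge_first_order _ _ _ b r clique l F G (fun S => beta01 #|S|) r_ge0
    (fun S => beta_ge #|S|) F0.
  apply: le_trans; rewrite -/t ler_wpM2r ?addr_ge0 //.
  apply: le_trans (prod_1B_ge _ _); last by move=> S _; apply: beta01.
  by rewrite lerD2l lerN2; apply: ler_sum => S _; apply: beta_le.
have ss : s * t <= (n%:R * p) ^+ 4.
  rewrite (_ : 4 = 2 + 2)%N // exprD ler_pM //; exact: le_trans ts s_le.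
by lra.
Qed.

Lemma iter_object_step_approx m F G : (forall G, 0 <= F G <= 1) ->
  iter m object_step F G <=
  iter m (runion b clique l) F G + m%:R * (2 * (n%:R * p) ^+ 4).
Proof.
set eps := 2 * _; move=> F01; elim: m G => [|m IH] G; first by rewrite mul0r addr0.
rewrite !iterS; apply: le_trans (object_step_le _ IH) _.
rewrite object_step_add_cst -natr1 mulrDl mul1r [_ + eps]addrC addrA lerD2r.
apply: object_step_approx => H.
elim: m {IH G} H => [|m IH] H //=; apply/andP; split.
  by apply: runion_ge0 => [S|G]; [exact: beta01 | case/andP: (IH G)].
by apply: runion_le1 => [S|G]; [exact: beta01 | case/andP: (IH G)].
Qed.

Lemma iter_object_step_compl m F G :
  iter m object_step (fun H => 1 - F H) G = 1 - iter m object_step F G.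
Proof.
elim: m G => //= m IH G; rewrite -object_step_compl; exact: runion_ext.
Qed.

Lemma iter_runion_compl m F G :
  iter m (runion b clique l) (fun H => 1 - F H) G =
  1 - iter m (runion b clique l) F G.
Proof.
elim: m G => //= m IH G; rewrite (runion_ext _ _ _ _ IH) runion_sub.
by rewrite runion_cst.
Qed.

Let pim m k := 1 - (1 - beta k) ^+ m.

Lemma iter_runionE m F :
  iter m (runion b clique l) F set0 =
  runion (fun=> pim m 3) clique (ksubsets n 3)
    (runion (fun=> pim m 2) clique (ksubsets n 2) F) set0.
Proof.
rewrite runion_iter /l runion_cat runion_commute.
rewrite (@runion_eq_prob_in _ _ _ _ (fun=> pim m 3)); last first.
  by move=> S; rewrite mem_ksubsets /b => /eqP->.
apply: runion_ext => G; apply: runion_eq_prob_in.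
by move=> S; rewrite mem_ksubsets /b => /eqP->.
Qed.

Let pim01 m k : 0 <= pim m k <= 1.
Proof.
have /andP[b0 b1] := beta01 k; rewrite /pim subr_ge0 gerBl.
by rewrite exprn_ile1 ?exprn_ge0 ?subr_ge0 // gerBl.
Qed.

Variables (m : nat) (F : {set 'I_n * 'I_n} -> K).
Hypothesis F_isotone : isotone F.
Hypothesis F01 : forall G, 0 <= F G <= 1.

Lemma intersection_ge_edges :
  runion (fun=> 1 - (1 - beta 2) ^+ m) clique (ksubsets n 2) F set0 <=
  iter m object_step F set0 + m%:R * (2 * (n%:R * p) ^+ 4).
Proof.
have F01' G : 0 <= 1 - F G <= 1 by have /andP[F0 F1] := F01 G; rewrite subr_ge0 gerBl F0 F1.
have := iter_object_step_approx m set0 F01'.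
rewrite iter_object_step_compl iter_runion_compl iter_runionE.
set g := runion (fun=> pim m 2) clique (ksubsets n 2) F.
have gi : isotone g by apply: runion_incr.
have : g set0 <= runion (fun=> pim m 3) clique (ksubsets n 3) g set0.
  rewrite -[leLHS](runion_cst (fun=> pim m 3) clique (ksubsets n 3) (g set0) set0).
  by apply: runion_le => // H _; rewrite gi ?sub0set.
rewrite -/(pim m 2) -/g; lra.
Qed.

(** The edges of the binomial graph are first averaged into [g], still isotone, so the triangles can
    be exchanged for G(n,q) inside [g]; then the two binomial graphs merge. *)
Lemma intersection_le_edges (q q' : K) :
    0 <= q <= 1 -> 1000 * (1 - (1 - beta 3) ^+ m) <= q ^+ 3 ->
    90 * (n%:R * q ^+ 2) <= 1 ->
    1 - (1 - beta 2) ^+ m * (1 - q) <= q' <= 1 ->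
  iter m object_step F set0 <=
  runion (fun=> q') clique (ksubsets n 2) F set0 +
  (5 / 2 * n%:R ^+ 6 * pim m 3 ^+ 3 +
   q ^+ 2 * (2025 * n%:R ^+ 7 * pim m 3 ^+ 3 + 3038 * n%:R ^+ 5 * pim m 3 ^+ 2)) +
  m%:R * (2 * (n%:R * p) ^+ 4).
Proof.
move=> q01 pi_q q_small qq'.
have := iter_object_step_approx m set0 F01; rewrite iter_runionE.
set g := runion (fun=> pim m 2) clique (ksubsets n 2) F.
have gi : isotone g by apply: runion_incr.
have g01 G : 0 <= g G <= 1.
  apply/andP; split; [apply: runion_ge0|apply: runion_le1] => // H;
  by case/andP: (F01 H).
have := triangles_le_edges q01 (pim01 m 3) pi_q q_small gi g01.
have : runion (fun=> q) clique (ksubsets n 2) g set0 <=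
       runion (fun=> q') clique (ksubsets n 2) F set0.
  rewrite runion_merge; apply: runion_le_prob => // S.
    have := pim01 m 2; move: q01 => /andP[q0 q1] /andP[p0 p1].
    rewrite subr_ge0 gerBl mulr_ge0 ?subr_ge0 //= andbT.
    apply: mulr_ile1; rewrite ?subr_ge0 ?gerBl //.
    by rewrite exprn_ge0 // subr_ge0; case/andP: (beta01 2).
  by rewrite mulrC /pim subKr.
move=> h1 h2 h3; apply: le_trans h3 _; rewrite lerD2r.
by apply: le_trans h2 _; rewrite lerD2r.
Qed.

End Objects.

(** The largest simple graph inside [G]. It extends a property, constrained only on simple graphs,
    to all sets of ordered pairs without losing monotonicity. *)
Definition core n (G : {set 'I_n * 'I_n}) : {set 'I_n * 'I_n} :=
  [set x in G | (x.1 != x.2) && ((x.2, x.1) \in G)].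

(** * Simple graphs, and both models as explicit sums *)

Section SimpleGraphs.

Context {n : nat}.
Implicit Types (G H : {set 'I_n * 'I_n}).

Lemma simple_graphP G :
  reflect ((forall u, (u, u) \notin G) /\ (forall u v, (u, v) \in G -> (v, u) \in G))
    (simple_graph G).
Proof.
apply: (iffP andP) => -[irr sym]; split.
- by move=> u; move/forallP: irr; apply.
- by move=> u v; move/forallP/(_ u)/forallP/(_ v)/implyP: sym.
- exact/forallP.
- by do 2 (apply/forallP => ?); apply/implyP/sym.
Qed.

Lemma core_id G : simple_graph G -> core G = G.
Proof.
case/simple_graphP=> irr sym; apply/setP => -[u v]; rewrite inE /=.
apply/andP/idP => [[]//|uvG]; split=> //; rewrite sym // andbT.
by apply: contraTneq uvG => ->.
Qed.

Lemma core_simple G : simple_graph (core G).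
Proof.
apply/simple_graphP; split=> [u|u v]; rewrite !inE /= ?eqxx ?andbF //.
by rewrite eq_sym => /and3P[-> -> ->].
Qed.

Lemma coreS G H : G \subset H -> core G \subset core H.
Proof.
move=> GH; apply/subsetP => -[u v]; rewrite !inE /= => /and3P[uv -> vu].
by rewrite !(subsetP GH).
Qed.

Lemma intersection_graph_simple m (S : {set 'I_n * 'I_m}) :
  simple_graph (intersection_graph S).
Proof.
apply/simple_graphP; split=> [u|u v]; rewrite !inE /= ?eqxx //.
rewrite eq_sym => /andP[-> /existsP[w /andP[uw vw]]].
by apply/existsP; exists w; rewrite uw vw.
Qed.

Lemma edge_union_simple (H : {set {set 'I_n}}) : simple_graph (edge_union H).
Proof.
apply/simple_graphP; split=> [u|u v].
  by apply/bigcupP => -[e _]; rewrite inE eqxx.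
case/bigcupP => e eH; rewrite inE /= => /and3P[uv ue ve].
by apply/bigcupP; exists e; rewrite // inE /= eq_sym uv ue ve.
Qed.

Definition edge_set G : {set {set 'I_n}} := [set [set x.1; x.2] | x in G].

(** An equivalence because it serves as the side condition when sums over simple graphs are
    reindexed by sets of 2-sets. *)
Lemma edge_unionK (H : {set {set 'I_n}}) :
  (edge_set (edge_union H) == H) = (H \subset [set e in ksubsets n 2]).
Proof.
apply/eqP/idP => [<-|/subsetP H2].
  apply/subsetP => e /imsetP[[u v] /bigcupP[e' _]].
  by rewrite !inE mem_ksubsets /= => /and3P[uv _ _] ->; rewrite cards2 uv.
have H2' e : e \in H -> exists u v, u != v /\ e = [set u; v].
  by move=> /H2; rewrite inE mem_ksubsets => /cards2P.
apply/setP => e; apply/imsetP/idP => [[[u v] /bigcupP[e' e'H]]|eH].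
  have [u' [v' [u'v' e'E]]] := H2' _ e'H; rewrite inE /= => /and3P[uv].
  rewrite e'E !inE => ue' ve' ->.
  suff -> : [set u; v] = e' by [].
  apply/eqP; rewrite eqEcard e'E !cards2 uv u'v' leqnn andbT.
  by apply/subsetP => w; rewrite !inE => /orP[]/eqP->.
have [u [v [uv eE]]] := H2' _ eH; exists (u, v); last by rewrite eE.
by apply/bigcupP; exists e => //; rewrite inE /= uv eE !inE !eqxx orbT.
Qed.

Lemma edge_setK G : simple_graph G -> edge_union (edge_set G) = G.
Proof.
case/simple_graphP=> irr sym; apply/setP => -[u v]; apply/bigcupP/idP; last first.
  move=> uvG; exists [set u; v]; first by apply/imsetP; exists (u, v).
  by rewrite !inE /= !eqxx orbT !andbT; apply: contraTneq uvG => ->.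
case=> e /imsetP[[u' v'] u'v'G ->]; rewrite !inE /= => /and3P[uv].
case/orP=> /eqP ue /orP[]/eqP ve; rewrite ue ve ?eqxx // in uv *.
exact: sym.
Qed.

Lemma card_edge_union (H : {set {set 'I_n}}) :
  H \subset [set e in ksubsets n 2] -> #|edge_union H| = (2 * #|H|)%N.
Proof.
move=> H2; have /eqP HK : edge_set (edge_union H) == H by rewrite edge_unionK.
rewrite -sum1_card (partition_big (fun x => [set x.1; x.2]) (mem H)) /=; last first.
  move=> x xH; have : [set x.1; x.2] \in edge_set (edge_union H).
    by apply/imsetP; exists x.
  by rewrite HK.
rewrite mulnC -sum_nat_const; apply: eq_bigr => e eH.
have /cards2P[u [v [uv eE]]] : #|e| == 2.
  by have := subsetP H2 _ eH; rewrite inE mem_ksubsets.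
rewrite (eq_bigl (fun x => x \in [set (u, v); (v, u)])) => [|[x y]] /=.
  by rewrite sum1_card cards2 xpair_eqE (negPf uv).
rewrite !inE !xpair_eqE; apply/andP/orP => [[/bigcupP[e' _]]|].
  rewrite inE /= => /and3P[xy _ _] /eqP/setP exy.
  have := exy x; have := exy y; rewrite eE !inE !eqxx orbT /=.
  move=> /esym/orP[]/eqP yE /esym/orP[]/eqP xE; move: xy; rewrite xE yE ?eqxx //= => _;
    by rewrite ?eqxx; auto.
move=> xyE; have xyeE : [set x; y] = e.
  by case: xyE => /andP[/eqP-> /eqP->]; rewrite eE // setUC.
split; last by rewrite xyeE.
apply/bigcupP; exists e => //; rewrite inE /= -xyeE !inE !eqxx orbT /= andbT.
by case: xyE => /andP[/eqP-> /eqP->] //; rewrite eq_sym.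
Qed.

Lemma size_ksubsets k : size (ksubsets n k) = 'C(n, k).
Proof. by rewrite -cardE card_draws card_ord. Qed.

Lemma binomial_graph_sum (K : realFieldType) (q : K) (F : {set 'I_n * 'I_n} -> K) :
  runion (fun=> q) clique (ksubsets n 2) F set0 =
  \sum_(G : {set 'I_n * 'I_n} | simple_graph G)
     q ^+ n_edges G * (1 - q) ^+ ('C(n, 2) - n_edges G) * F G.
Proof.
rewrite -rsubset_cliques rsubset_sum ?ksubsets_uniq //.
rewrite [RHS](reindex_onto edge_union edge_set) /=; last exact: edge_setK.
apply: eq_big => [H|H H2]; first by rewrite edge_union_simple edge_unionK.
by rewrite /n_edges card_edge_union // mulKn // size_ksubsets.
Qed.

Lemma iter_object_step_sum (K : realFieldType) (p : K) m
    (F : {set 'I_n * 'I_n} -> K) G :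
  iter m (object_step p) F G =
  \sum_(h : {ffun 'I_m -> {set 'I_n}})
    (\prod_(w < m) (p ^+ #|h w| * (1 - p) ^+ (n - #|h w|))) *
    F ((\bigcup_(w < m) clique (h w)) :|: G).
Proof.
elim: m G => [|m IH] G.
  rewrite (big_pred1 [ffun=> set0]) ?big_ord0 ?mul1r ?set0U // => h.
  by apply/esym/eqP/ffunP => -[].
rewrite iterS /object_step rsubset_sum ?enum_uniq //.
transitivity (\sum_(S : {set 'I_n}) \sum_(h : {ffun 'I_m -> {set 'I_n}})
    (p ^+ #|S| * (1 - p) ^+ (n - #|S|)) *
    ((\prod_(w < m) (p ^+ #|h w| * (1 - p) ^+ (n - #|h w|))) *
    F ((\bigcup_(w < m) clique (h w)) :|: (clique S :|: G)))).
  apply: eq_big => [S|S _]; first by apply/subsetP => x _; rewrite inE mem_enum.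
  by rewrite size_enum_ord IH mulr_sumr.
rewrite pair_big /=.
pose cons_ff (x : {set 'I_n} * {ffun 'I_m -> {set 'I_n}}) :=
  [ffun w : 'I_m.+1 => oapp x.2 x.1 (unlift ord0 w)].
rewrite [RHS](reindex cons_ff) /=; last first.
  exists (fun h => (h ord0, [ffun w => h (lift ord0 w)])) => [[S h] _|h _].
    congr pair; first by rewrite ffunE unlift_none.
    by apply/ffunP => w; rewrite !ffunE liftK.
  apply/ffunP => w; rewrite ffunE; case: unliftP => [j ->|->] //=.
  by rewrite ffunE.
apply: eq_bigr => -[S h] _; rewrite /= big_ord_recl ffunE unlift_none /= !mulrA.
congr (_ * _ * F _).
  by apply: eq_bigr => w _; rewrite ffunE liftK.
rewrite big_ord_recl ffunE unlift_none /= setUA [_ :|: clique S]setUC.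
by congr (_ :|: _ :|: _); apply: eq_bigr => w _; rewrite ffunE liftK.
Qed.

(** The configuration is read by objects: the vertices choosing [w] form a random set, independently
    over [w], and span a clique. *)
Lemma intersection_graph_sum (K : realFieldType) (p : K) m
    (F : {set 'I_n * 'I_n} -> K) :
  iter m (object_step p) F set0 =
  \sum_(S : {set 'I_n * 'I_m})
    p ^+ #|S| * (1 - p) ^+ (n * m - #|S|) * F (intersection_graph S).
Proof.
rewrite iter_object_step_sum.
pose of_set (S : {set 'I_n * 'I_m}) := [ffun w : 'I_m => [set v : 'I_n | (v, w) \in S]].
rewrite (reindex of_set) /=; last first.
  exists (fun h : {ffun 'I_m -> {set 'I_n}} => [set x : 'I_n * 'I_m | x.1 \in h x.2]).
    by move=> S _; apply/setP => -[v w]; rewrite !inE ffunE inE.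
  by move=> h _; apply/ffunP => w; apply/setP => v; rewrite ffunE !inE.
apply: eq_bigr => S _.
have cardS : (\sum_(w < m) #|of_set S w| = #|S|)%N.
  rewrite -sum1_card (partition_big snd predT) //=; apply: eq_bigr => w _.
  rewrite ffunE -sum1dep_card (reindex_onto (fun v => (v, w)) fst) /=; last first.
    by move=> [v w'] /andP[_ /eqP/= ->].
  by apply: eq_bigl => v; rewrite !eqxx !andbT.
have cardSC : (\sum_(w < m) (n - #|of_set S w|) = n * m - #|S|)%N.
  rewrite -cardS; apply/eqP; rewrite -(eqn_add2r (\sum_(w < m) #|of_set S w|)).
  rewrite -big_split /= subnK; last first.
    rewrite mulnC -[X in (_ <= X * _)%N]card_ord -sum_nat_const; apply: leq_sum => w _.
    by rewrite -[leqRHS]card_ord max_card.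
  rewrite (eq_bigr (fun=> n)) ?sum_nat_const ?card_ord 1?mulnC // => w _.
  by rewrite subnK // -[leqRHS]card_ord max_card.
rewrite big_split /= !prodrXr cardS cardSC setU0; congr (_ * F _).
apply/setP => -[u v]; rewrite !inE /=; apply/bigcupP/andP => [[w _]|[uv /existsP[w]]].
  rewrite !inE ffunE !inE /= => /and3P[uv uw vw]; split=> //.
  by apply/existsP; exists w; rewrite uw.
by move=> /andP[uw vw]; exists w; rewrite // !inE ffunE !inE /= uv uw.
Qed.

End SimpleGraphs.

(** * Real probabilities and limits *)

Section RealProbabilities.

Lemma sumRE (T : finType) (f : T -> R) : sumR f = \sum_(x : T) f x.
Proof.
rewrite /sumR -big_enum /=; elim: (enum T) => [|x s IH] /=; first by rewrite big_nil.
by rewrite big_cons IH.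
Qed.

Definition core_indicator (A : graph_property) n (G : {set 'I_n * 'I_n}) : R :=
  (A n (core G))%:R.

Lemma core_indicator01 A n (G : {set 'I_n * 'I_n}) : 0 <= core_indicator A G <= 1.
Proof. by rewrite /core_indicator; case: (A n _); rewrite ?lexx ler01. Qed.

Lemma prob_GnpE A n q :
  prob_Gnp A n q =
  runion (fun=> clamp01 q) clique (ksubsets n 2) (@core_indicator A n) set0.
Proof.
rewrite binomial_graph_sum /prob_Gnp sumRE [RHS]big_mkcond; apply: eq_bigr => G _ /=.
have [Gs|] := boolP (simple_graph G) => //=; rewrite /core_indicator core_id //.
by rewrite !RpowE; case: (A n G); rewrite ?mulr1 ?mulr0.
Qed.

Lemma prob_GnmpE A n m p :
  prob_Gnmp A n m p = iter m (object_step p) (@core_indicator A n) set0.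
Proof.
rewrite intersection_graph_sum /prob_Gnmp sumRE; apply: eq_bigr => S _ /=.
rewrite /core_indicator core_id ?intersection_graph_simple //.
by rewrite !RpowE; case: (A n _); rewrite ?mulr1 ?mulr0.
Qed.

Lemma clamp01_id (x : R) : 0 <= x <= 1 -> clamp01 x = x.
Proof. by case/andP=> x0 x1; rewrite /clamp01 RmaxE RminE min_r // max_r. Qed.

(** Inserting 90 n q^2 <= 1 into the mean of [bad_count] gives 5/2 + 2025/90 = 25 and 3038/90 <= 34;
    the last term is the cost of exchanging objects for cliques. *)
Definition comparison_error (n m : nat) (p : R) :=
  let z := n%:R ^+ 2 * (m%:R * p ^+ 3) in
  25 * z ^+ 3 + 34 * z ^+ 2 + 2 * (m%:R * (n%:R * p) ^+ 4).

Lemma exp_complement (x : R) :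
  0 <= x -> [/\ 0 <= 1 - exp (- x) <= 1, 1 - exp (- x) <= x &
             x * exp (- x) <= 1 - exp (- x)].
Proof.
move=> x0.
have h1 : 1 - x <= exp (- x) by exact/RleP/exp_ineq1_le.
have h2 : 1 + x <= exp x by exact/RleP/exp_ineq1_le.
have e0 : 0 < exp (- x) by apply/RltP/exp_pos.
have e1 : exp x * exp (- x) = 1 by rewrite expRD RplusE RoppE subrr expR0.
have h3 : 0 <= exp (- x) * (exp x - (1 + x)) by rewrite mulr_ge0 ?subr_ge0 // ltW.
have e2 : exp (- x) <= 1 by have : 0 <= exp (- x) * x := mulr_ge0 (ltW e0) x0; lra.
by split; [apply/andP; split| |]; lra.
Qed.

(** * Both comparisons for fixed parameters *)

Section Finite.

Variables (n m : nat) (p : R) (F : {set 'I_n * 'I_n} -> R).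
Hypothesis p01 : 0 <= p <= 1.
Hypothesis p0 : 0 < p.
Hypothesis n1 : 1 <= n%:R :> R.
Hypothesis m0 : 0 < m%:R :> R.
Hypothesis z_small : n%:R ^+ 2 * (m%:R * p ^+ 3) <= (1 / 100) ^+ 3.
Hypothesis F_isotone : isotone F.
Hypothesis F01 : forall G, 0 <= F G <= 1.

Let P := (m%:R : R) * p ^+ 3.
Let q := 10 * cbrt P.
Let sp k := @subset_prob _ n p k.
Let beta k := 1 - exp (- sp k).

Let P0 : 0 < P. Proof. by rewrite mulr_gt0 ?exprn_gt0. Qed.

Let P_ge0 : 0 <= P. Proof. exact: ltW. Qed.

Let q_gt0 : 0 < q.
Proof. by rewrite mulr_gt0 //; apply/RltP/exp_pos. Qed.

(** Positivity of [P] matters: [cbrt] goes through [ln], whose default value makes [cbrt 0] equal to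
    1. *)
Let q3 : q ^+ 3 = 1000 * P.
Proof.
have /RltP/cbrt_cube := P0; rewrite RpowE => e; rewrite /q exprMn e; congr (_ * _).
by rewrite -natrX.
Qed.

Let P_le : P <= (1 / 100) ^+ 3.
Proof.
apply: le_trans z_small; exact: ler_peMl (ltW P0) (exprn_ege1 _ n1).
Qed.

Let cube_le1 (x : R) : x ^+ 3 <= 1 -> x <= 1.
Proof.
by move=> x3; rewrite leNgt; apply/negP => x1; move: x3; rewrite leNgt exprn_egt1.
Qed.

Let q01 : 0 <= q <= 1.
Proof. by rewrite ltW //=; apply: cube_le1; rewrite q3; move: P_le; lra. Qed.

Let q_small : 90 * (n%:R * q ^+ 2) <= 1.
Proof.
(* Cubing removes the cube root: the cube is 90^3 10^6 n^3 P^2, at most 0.729 since n^3 P^2 <= n^4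
   P^2 <= 10^(-12). *)
apply: cube_le1.
have -> : (90 * (n%:R * q ^+ 2)) ^+ 3 = 90 ^+ 3 * n%:R ^+ 3 * (q ^+ 3) ^+ 2 by ring.
rewrite q3; have z0 : 0 <= n%:R ^+ 2 * P by rewrite mulr_ge0 // exprn_ge0.
have h1 : (n%:R ^+ 2 * P) ^+ 2 <= ((1 / 100) ^+ 3) ^+ 2.
  by rewrite lerXn2r ?nnegrE // exprn_ge0 // divr_ge0.
have h2 : 0 <= n%:R ^+ 3 * P ^+ 2 * (n%:R - 1).
  by rewrite !mulr_ge0 ?exprn_ge0 ?subr_ge0 // ltW.
by move: h1 h2; lra.
Qed.

Let sp_ge0 k : 0 <= sp k.
Proof.
by case/andP: p01 => h0 h1; rewrite mulr_ge0 ?exprn_ge0 ?subr_ge0.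
Qed.

Let beta01 k : 0 <= beta k <= 1. Proof. by case: (exp_complement (sp_ge0 k)). Qed.
Let beta_le k : beta k <= sp k. Proof. by case: (exp_complement (sp_ge0 k)). Qed.
Let beta_ge k : sp k * (1 - beta k) <= beta k.
Proof. by rewrite /beta subKr; case: (exp_complement (sp_ge0 k)). Qed.

(** This is why [beta] has an exponential form: [m] merged copies give [p_minus] exactly for k = 2,
    with no further error. *)
Let pow_beta k : (1 - beta k) ^+ m = exp (- (m%:R * sp k)).
Proof. by rewrite /beta subKr expRX; congr exp; rewrite -[LHS]mulr_natl; apply: mulrN. Qed.

Let p_minusE : p_minus n m p = 1 - (1 - beta 2) ^+ m.
Proof.
rewrite pow_beta /p_minus RminusE; congr (_ - exp (Ropp _)).
by rewrite INRE !RpowE; apply/esym/mulrA.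
Qed.

Let p_plusE : p_plus n m p = p_minus n m p + q.
Proof. by rewrite /p_plus -/(p_minus n m p) RplusE IZRposE !INRE RpowE. Qed.

Let pi3 : 1 - (1 - beta 3) ^+ m <= P.
Proof.
rewrite pow_beta.
have [_ h _] := exp_complement (mulr_ge0 (ltW m0) (sp_ge0 3)).
apply: le_trans h _; rewrite /P ler_pM2l // /sp /subset_prob ler_piMr ?exprn_ge0 ?(ltW p0) //.
by case/andP: p01 => h0 h1; rewrite exprn_ile1 ?subr_ge0 // gerBl.
Qed.

Let pim01 k : 0 <= 1 - (1 - beta k) ^+ m <= 1.
Proof.
have /andP[b0 b1] := beta01 k; rewrite subr_ge0 gerBl.
by rewrite exprn_ile1 ?exprn_ge0 ?subr_ge0 // gerBl.
Qed.

Let objects_error : m%:R * (2 * (n%:R * p) ^+ 4) = 2 * (m%:R * (n%:R * p) ^+ 4).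
Proof. ring. Qed.

Lemma Gnp_minus_le :
  runion (fun=> clamp01 (p_minus n m p)) clique (ksubsets n 2) F set0 <=
  iter m (object_step p) F set0 + comparison_error n m p.
Proof.
rewrite p_minusE clamp01_id //.
apply: le_trans (intersection_ge_edges p01 beta01 beta_le beta_ge m F_isotone F01) _.
rewrite lerD2l objects_error lerDr.
have z0 : 0 <= n%:R ^+ 2 * P by rewrite mulr_ge0 // exprn_ge0.
by apply: addr_ge0; apply: mulr_ge0 => //; apply: exprn_ge0.
Qed.

Lemma le_Gnp_plus :
  iter m (object_step p) F set0 <=
  runion (fun=> clamp01 (p_plus n m p)) clique (ksubsets n 2) F set0 +
  comparison_error n m p.
Proof.
(* With x = [p_minus], the merged graph has edge probability x + q - x q, at most both 1 and x + q,
   so clamping [p_plus] is harmless. *)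
have q' : 1 - (1 - beta 2) ^+ m * (1 - q) <= clamp01 (p_plus n m p) <= 1.
  have /andP[x0 x1] := pim01 2; have /andP[q0 q1] := q01.
  rewrite /clamp01 RmaxE RminE R1E R0E p_plusE p_minusE.
  move: x0 x1; set x := 1 - (1 - beta 2) ^+ m => x0 x1.
  have -> : (1 - beta 2) ^+ m = 1 - x by rewrite /x [RHS]subKr.
  have h1 : 0 <= x * q by rewrite mulr_ge0.
  have h2 : 0 <= (1 - x) * (1 - q) by rewrite mulr_ge0 ?subr_ge0.
  rewrite le_max le_min ge_max ge_min ler01 lexx /=.
  by rewrite andbT; apply/orP; right; apply/andP; split; lra.
have pi_q : 1000 * (1 - (1 - beta 3) ^+ m) <= q ^+ 3 by rewrite q3 ler_pM2l.
have := intersection_le_edges p01 beta01 beta_le beta_ge F_isotone F01 q01 pi_q q_small q'.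
move=> h; apply: le_trans h _; rewrite objects_error /comparison_error -addrA lerD2l lerD2r.
set x := 1 - (1 - beta 3) ^+ m; rewrite -/P.
have /andP[x0 _] := pim01 3.
have h2 : x ^+ 2 <= P ^+ 2 by rewrite lerXn2r // nnegrE ltW.
have h3 : x ^+ 3 <= P ^+ 3 by rewrite lerXn2r // nnegrE ltW.
have N0 : 0 <= n%:R :> R by [].
have Q0 : 0 <= q ^+ 2 by rewrite sqr_ge0.
apply: le_trans (_ : 5 / 2 * n%:R ^+ 6 * P ^+ 3 +
  q ^+ 2 * (2025 * n%:R ^+ 7 * P ^+ 3 + 3038 * n%:R ^+ 5 * P ^+ 2) <= _).
  by apply: lerD; last apply: ler_wpM2l => //; last apply: lerD; apply: ler_wpM2l => //;
     rewrite mulr_ge0 ?exprn_ge0 // divr_ge0.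
have g1 : 0 <= (1 - 90 * (n%:R * q ^+ 2)) * (n%:R ^+ 6 * P ^+ 3).
  by rewrite mulr_ge0 ?subr_ge0 // mulr_ge0 ?exprn_ge0 // ltW.
have g2 : 0 <= (1 - 90 * (n%:R * q ^+ 2)) * (n%:R ^+ 4 * P ^+ 2).
  by rewrite mulr_ge0 ?subr_ge0 // mulr_ge0 ?exprn_ge0 // ltW.
have g3 : 0 <= n%:R ^+ 4 * P ^+ 2 by rewrite mulr_ge0 ?exprn_ge0 // ltW.
move: g1 g2 g3; move: (n%:R : R) (q : R) (P : R) => N Q P'; lra.
Qed.

End Finite.

End RealProbabilities.

(** * Passage to the limit *)

Lemma core_indicator_isotone A n : Defs.increasing_prop A -> isotone (@core_indicator A n).
Proof.
move=> Ai G H GH; rewrite /core_indicator ler_nat.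
have := Ai n _ _ (core_simple G) (core_simple H) (coreS GH).
by case: (A n (core G)) => // ->.
Qed.

Lemma core_indicator_compl_isotone A n :
  Defs.decreasing_prop A -> isotone (fun G => 1 - @core_indicator A n G).
Proof.
move=> Ad G H GH; rewrite lerD2l lerN2 /core_indicator ler_nat.
have := Ad n _ _ (core_simple G) (core_simple H) (coreS GH).
by case: (A n (core H)) => // ->.
Qed.

Lemma eventually_small (alpha c C : R) (m : nat -> nat) (p : nat -> R) : Rlt 4 alpha ->
    (forall n : nat, Rle (INR (m n)) (Rpower (INR n) alpha) /\
                     Rlt (Rpower (INR n) alpha) (INR (m n) + 1)) ->
    (forall n : nat, Rle 0 (p n) /\ Rle (p n) 1) -> Rlt 0 c -> Rlt 0 C ->
    (exists N : nat, forall n : nat, (N <= n)%N ->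
      Rle (c * / (INR n * cbrt (INR (m n)))) (p n)) ->
    (exists N : nat, forall n : nat, (N <= n)%N ->
      Rle (p n) (C * sqrt (ln (INR n) / INR (m n)))) ->
  forall eps : R, 0 < eps -> exists N : nat, forall n : nat, (N <= n)%N ->
    [/\ 0 < p n, 1 <= n%:R :> R, 0 < (m n)%:R :> R,
        n%:R ^+ 2 * ((m n)%:R * p n ^+ 3) <= (1 / 100) ^+ 3 &
        comparison_error n (m n) (p n) <= eps].
Proof.
move=> a4 hm p01 c0 C0 [N1 h1] [N2 h2] eps e0.
(* 61 = 25 + 34 + 2, once z <= 1 bounds z^2 and z^3 by z. *)
pose d := Num.min ((1 / 100) ^+ 3) (eps / 61).
have d0 : 0 < d by rewrite lt_min exprn_gt0 ?divr_gt0.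
have h2' : exists N : nat, forall n : nat, (N <= n)%coq_nat ->
    Rle (p n) (C * sqrt (ln (INR n) / INR (m n))) by exists N2 => n /ssrnat.leP/h2.
have /RltP/(regime alpha C m p a4 hm p01 C0 h2')[N3 h3] := d0.
exists (N1 + N3)%N => n nN.
have /ssrnat.leP/h3[n3 [m0 [z y]]] := leq_trans (leq_addl _ _) nN.
have pn := h1 n (leq_trans (leq_addr _ _) nN).
have m_gt0 : 0 < (m n)%:R :> R by rewrite -INRE; apply/RltP.
have n_ge1 : 1 <= n%:R :> R.
  by rewrite -INRE; apply/RleP; apply: Rle_trans n3; apply/RleP; rewrite IZRposE INRE ler1n.
(* The lower bound on [p] gives the positivity on which [cbrt] depends. *)
have p_gt0 : 0 < p n.
  apply: lt_le_trans (_ : c * (INR n * cbrt (INR (m n)))^-1 <= _); last exact/RleP.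
  rewrite mulr_gt0 //; first exact/RltP.
  rewrite invr_gt0 mulr_gt0 //; first by rewrite INRE; apply: lt_le_trans n_ge1.
  exact/RltP/exp_pos.
have {}z : n%:R ^+ 2 * ((m n)%:R * p n ^+ 3) < d by apply/RltP; rewrite -!INRE -!RpowE.
have {}y : (m n)%:R * (n%:R * p n) ^+ 4 < d by apply/RltP; rewrite -!INRE -RpowE.
have dmin : d <= (1 / 100) ^+ 3 by rewrite ge_min lexx.
have deps : d <= eps / 61 by rewrite ge_min lexx orbT.
split=> //; first exact: le_trans (ltW z) dmin.
rewrite /comparison_error; move: z y.
have : 0 <= n%:R ^+ 2 * ((m n)%:R * p n ^+ 3).
  by rewrite mulr_ge0 ?exprn_ge0 // mulr_ge0 ?exprn_ge0 // ltW.
move: (_ ^+ 2 * _) (_ * _ ^+ 4) => Z Y Z0 Zd Yd.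
have Z1 : Z <= 1 by lra.
have Z2 : Z ^+ 2 <= Z by rewrite expr2 ler_piMr.
have Z3 : Z ^+ 3 <= Z by rewrite exprS; apply: ler_piMr => //; exact: exprn_ile1.
lra.
Qed.

Local Close Scope ring_scope.
Open Scope R_scope.

Theorem theorem3 (a : R) (A : graph_property) (alpha : R) (m : nat -> nat)
  (p : nat -> R) :
  0 <= a <= 1 ->
  monotone_property A ->
  4 < alpha ->
  (* m = n^alpha, rounded down to an integer *)
  (forall n : nat, INR (m n) <= Rpower (INR n) alpha < INR (m n) + 1) ->
  (* p is a probability *)
  (forall n : nat, 0 <= p n <= 1) ->
  (* p = Omega(1 / (n * m^(1/3))) *)
  (exists c : R, 0 < c /\ exists N : nat, forall n : nat, (N <= n)%nat ->
      c * / (INR n * cbrt (INR (m n))) <= p n) ->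
  (* p = O(sqrt(ln n / m)) *)
  (exists C : R, 0 < C /\ exists N : nat, forall n : nat, (N <= n)%nat ->
      p n <= C * sqrt (ln (INR n) / INR (m n))) ->
  Un_cv (fun n => prob_Gnp A n (p_minus n (m n) (p n))) a ->
  Un_cv (fun n => prob_Gnp A n (p_plus n (m n) (p n))) a ->
  Un_cv (fun n => prob_Gnmp A n (m n) (p n)) a.
Proof.
move=> _ [_ Amon] a4 hm p01 [c [c0 lowp]] [C [C0 upp]] cvm cvp.
have small := eventually_small a4 hm p01 c0 C0 lowp upp.
have p01' n : (0 <= p n <= 1)%R.
  by have [p0 p1] := p01 n; apply/andP; split; apply/RleP.
case: Amon => [Ai|Ad].
  apply: Un_cv_squeeze cvm cvp _ => eps /RltP/small[N hN]; exists N => n /ssrnat.leP/hN[pn n1 m0 z err].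
  have Fi := @core_indicator_isotone A n Ai.
  have := Gnp_minus_le (p01' n) pn m0 Fi (@core_indicator01 A n).
  have := le_Gnp_plus (p01' n) pn n1 m0 z Fi (@core_indicator01 A n).
  rewrite -!prob_GnpE -prob_GnmpE => up low.
  by split; apply/RleP; move: up low err; rewrite ?RplusE ?RminusE; lra.
(* For a decreasing property the complement of the indicator is isotone, so [p_plus] and [p_minus]
   exchange their roles. *)
apply: Un_cv_squeeze cvp cvm _ => eps /RltP/small[N hN]; exists N => n /ssrnat.leP/hN[pn n1 m0 z err].
have Fi := @core_indicator_compl_isotone A n Ad.
have F01 (G : {set 'I_n * 'I_n}) : (0 <= 1 - core_indicator A G <= 1)%R.
  by have /andP[F0 F1] := core_indicator01 A G; rewrite subr_ge0 gerBl F0 F1.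
have := Gnp_minus_le (p01' n) pn m0 Fi F01.
have := le_Gnp_plus (p01' n) pn n1 m0 z Fi F01.
rewrite iter_object_step_compl !runion_sub !runion_cst -!prob_GnpE -prob_GnmpE => up low.
by split; apply/RleP; move: up low err; rewrite ?RplusE ?RminusE; lra.
Qed.
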